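(* Let $n\in\mathbb{N}$, $k\in\{1,\ldots,n\}$, and let $\mathbb{V}$ be a $k$-dimensional horizontal subgroup of the Heisenberg group $\mathbb{H}^n$ with complementary vertical subgroup $\mathbb{W}$. Then for every $L\ge 0$ there exists a constant $L'=L'(L,k,n)\ge 0$ (depending only on $L$, $k$, $n$) such that every intrinsic $L$-Lipschitz function $\phi:E\to\mathbb{W}$, defined on a subset $E\subset\mathbb{V}$, can be extended to an intrinsic $L'$-Lipschitz function $\overline{\phi}:\mathbb{V}\to\mathbb{W}$. Moreover, if $k=n=1$, then one can take $L'=C(n)\max\{L,L^2\}$, where $C(n)\ge 1$ is a constant depending only on $n$.
   Context: The $n$-th Heisenberg group $\mathbb{H}^n$ is $\mathbb{R}^{2n+1}$ with the group product $$(x_1,\ldots,x_{2n},t)\cdot(x_1',\ldots,x_{2n}',t')=\Big(x_1+x_1',\ldots,x_{2n}+x_{2n}',\,t+t'+\tfrac12\sum_{i=1}^n (x_ix_{n+i}'-x_i'x_{n+i})\Big).$$ For $(x,t)\in\mathbb{R}^{2n}\times\mathbb{R}$ put $\|(x,t)\|:=\max\{|x|,\sqrt{|t|}\}$, where $|\cdot|$ is the Euclidean norm. A $k$-dimensional horizontal subgroup ($1\le k\le n$) is a set $\mathbb{V}=V\times\{0\}$, where $V$ is a $k$-dimensional isotropic subspace of $\mathbb{R}^{2n}$ with the standard symplectic form $\omega(x,x')=\sum_{i=1}^n(x_ix'_{n+i}-x'_ix_{n+i})$. The complementary vertical subgroup is $\mathbb{W}=V^{\perp}\times\mathbb{R}$,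 with $V^\perp$ the Euclidean orthogonal complement of $V$ in $\mathbb{R}^{2n}$. Every $p\in\mathbb{H}^n$ can be written uniquely as $p=\pi_{\mathbb{V}}(p)\cdot\pi_{\mathbb{W}}(p)$ with $\pi_{\mathbb{V}}(p)\in\mathbb{V}$, $\pi_{\mathbb{W}}(p)\in\mathbb{W}$. For $E\subset\mathbb{V}$ and $L\ge0$, a map $\phi:E\to\mathbb{W}$ is intrinsic $L$-Lipschitz if, with the graph map $\Phi(v):=v\cdot\phi(v)$, $$\|\pi_{\mathbb{W}}(\Phi(v')^{-1}\cdot\Phi(v))\|\le L\,\|\pi_{\mathbb{V}}(\Phi(v')^{-1}\cdot\Phi(v))\|\quad\text{for all }v,v'\in E.$$ *)

(* Defs.v *)
From HB Require Import structures.
From mathcomp Require Import all_boot all_order all_algebra.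
From mathcomp Require Import all_classical all_reals.
From mathcomp Require Import ring lra.
Set Implicit Arguments.
Unset Strict Implicit.
Unset Printing Implicit Defensive.
Import Order.TTheory GRing.Theory Num.Theory.
Local Open Scope classical_set_scope.
Local Open Scope ring_scope.

Section Euclidean.
Variables (R : realType) (m : nat).
Implicit Types x y : 'rV[R]_m.

Definition dot x y : R := \sum_(i < m) x 0 i * y 0 i.

Definition enorm x : R := Num.sqrt (dot x x).

Lemma dotE x y : dot x y = (x *m y^T) 0 0.
Proof. by rewrite mxE; apply: eq_bigr => i _; rewrite mxE. Qed.

Lemma dot_eq0 x : dot x x = 0 -> x = 0.
Proof.
move=> /eqP; rewrite psumr_eq0 => [/allP x0|i _]; last by rewrite -expr2 sqr_ge0.
apply/rowP => i; rewrite mxE; apply/eqP.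
by have := x0 i (mem_index_enum i); rewrite /= mulf_eq0 orbb.
Qed.

Lemma dotDl x y z : dot (x + y) z = dot x z + dot y z.
Proof. by rewrite !dotE mulmxDl mxE. Qed.

Lemma dotNl x z : dot (- x) z = - dot x z.
Proof. by rewrite !dotE mulNmx mxE. Qed.

Lemma dotC x y : dot x y = dot y x.
Proof. by apply: eq_bigr => i _; rewrite mulrC. Qed.

(* Existence of the orthogonal decomposition, via a rank count on row spaces. *)
Lemma orth_decomp (U : {vspace 'rV[R]_m}) x :
  exists2 a, a \in U & forall u, u \in U -> dot u (x - a) = 0.
Proof.
pose B := \matrix_(i < \dim U) (vbasis U)`_i.
have BU (u : 'rV_m) : (u <= B)%MS = (u \in U).
  apply/idP/idP => [/submxP[c ->]|uU].
    rewrite mulmx_sum_row; apply: memv_suml => i _; rewrite rowK memvZ //.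
    by apply: vbasis_mem; rewrite mem_nth // size_tuple.
  rewrite (coord_vbasis uU); apply: summx_sub => i _.
  by apply: scalemx_sub; rewrite -[_`_i](rowK (fun j => (vbasis U)`_j)) row_sub.
pose K := kermx B^T.
have BK0 : (B :&: K = 0)%MS.
  apply/eqP; rewrite -submx0; apply/row_subP => i.
  have := row_sub i (B :&: K)%MS; set r := row _ _.
  rewrite sub_capmx => /andP[/submxP[c rB] /sub_kermxP rK].
  have -> : r = 0; last exact: sub0mx.
  by apply: dot_eq0; rewrite dotE {2}rB trmx_mul mulmxA rK mul0mx mxE.
have full : row_full (B + K)%MS.
  rewrite /row_full; have := mxrank_sum_cap B K; rewrite BK0 mxrank0 addn0 => ->.
  by rewrite mxrank_ker mxrank_tr subnKC ?rank_leq_col.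
have /sub_addsmxP[[c d] xE] : (x <= B + K)%MS by rewrite submx_full.
exists (c *m B); first by rewrite -BU submxMl.
move=> u; rewrite -BU => /submxP[e ->].
rewrite xE /= addrC addKr dotC dotE trmx_mul mulmxA -(mulmxA d) mulmx_ker.
by rewrite mulmx0 mul0mx mxE.
Qed.

End Euclidean.

Section Heisenberg.
Variables (R : realType) (n : nat).

Definition omega (x y : 'rV[R]_(n + n)) : R :=
  \sum_(i < n) (x 0 (lshift n i) * y 0 (rshift n i)
                - y 0 (lshift n i) * x 0 (rshift n i)).

Lemma omegaDl x y z : omega (x + y) z = omega x z + omega y z.
Proof. by rewrite -big_split /=; apply: eq_bigr => i _; rewrite !mxE; ring. Qed.

Lemma omegaDr x y z : omega x (y + z) = omega x y + omega x z.
Proof. by rewrite -big_split /=; apply: eq_bigr => i _; rewrite !mxE; ring. Qed.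

Lemma omegaNl x y : omega (- x) y = - omega x y.
Proof. by rewrite /omega -sumrN /=; apply: eq_bigr => i _; rewrite !mxE; ring. Qed.

Lemma omegaNr x y : omega x (- y) = - omega x y.
Proof. by rewrite /omega -sumrN /=; apply: eq_bigr => i _; rewrite !mxE; ring. Qed.

Lemma omegaxx x : omega x x = 0.
Proof. by rewrite /omega big1 // => i _; rewrite subrr. Qed.

(* A structure of its own, not a pair: pairs already carry the additive group
   structure and the componentwise product. *)
Record heis := Heis { hx : 'rV[R]_(n + n); ht : R }.

Definition heis_pair (p : heis) := (hx p, ht p).
Definition pair_heis (p : 'rV[R]_(n + n) * R) := Heis p.1 p.2.
Lemma heis_pairK : cancel heis_pair pair_heis. Proof. by case. Qed.

HB.instance Definition _ := Choice.copy heis (can_type heis_pairK).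

Definition heis_mul (p q : heis) : heis :=
  Heis (hx p + hx q) (ht p + ht q + 2^-1 * omega (hx p) (hx q)).
Definition heis_one : heis := Heis 0 0.
Definition heis_inv (p : heis) : heis := Heis (- hx p) (- ht p).

Lemma heis_mulA : associative heis_mul.
Proof.
move=> [x s] [y t] [z u]; rewrite /heis_mul /= addrA omegaDl omegaDr.
by congr Heis; ring.
Qed.

Lemma heis_mul1 : left_id heis_one heis_mul.
Proof.
move=> [x s]; rewrite /heis_mul /= add0r.
have -> : omega 0 x = 0 by rewrite /omega big1 // => i _; rewrite !mxE; ring.
by congr Heis; ring.
Qed.

Lemma heis_1mul : right_id heis_one heis_mul.
Proof.
move=> [x s]; rewrite /heis_mul /= addr0.
have -> : omega x 0 = 0 by rewrite /omega big1 // => i _; rewrite !mxE; ring.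
by congr Heis; ring.
Qed.

Lemma heis_mulV : left_inverse heis_one heis_inv heis_mul.
Proof.
move=> [x s]; rewrite /heis_mul /= omegaNl omegaxx addNr /heis_one.
by congr Heis; ring.
Qed.

Lemma heis_Vmul : right_inverse heis_one heis_inv heis_mul.
Proof.
move=> [x s]; rewrite /heis_mul /= omegaNr omegaxx subrr /heis_one.
by congr Heis; ring.
Qed.

HB.instance Definition _ := isGroup.Build heis
  heis_mulA heis_mul1 heis_1mul heis_mulV heis_Vmul.

Lemma heis_mulE (p q : heis) :
  (p * q)%g = Heis (hx p + hx q) (ht p + ht q + 2^-1 * omega (hx p) (hx q)).
Proof. by []. Qed.

Lemma heis_invE (p : heis) : (p^-1)%g = Heis (- hx p) (- ht p).
Proof. by []. Qed.

Definition hnorm (p : heis) : R :=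
  Num.max (enorm (hx p)) (Num.sqrt `|ht p|).

Definition isotropic (U : {vspace 'rV[R]_(n + n)}) : Prop :=
  forall x y, x \in U -> y \in U -> omega x y = 0.

Variable U : {vspace 'rV[R]_(n + n)}.

Definition hsub : set heis := [set p | hx p \in U /\ ht p = 0].

Definition vsub : set heis :=
  [set p | forall u, u \in U -> dot u (hx p) = 0].

Definition decomp (p : heis) : set (heis * heis) :=
  [set vw | [/\ hsub vw.1, vsub vw.2 & p = (vw.1 * vw.2)%g]].

Lemma decomp_exists_unique p : exists! vw, decomp p vw.
Proof.
have [a aU ao] := orth_decomp U (hx p).
exists (Heis a 0, Heis (hx p - a) (ht p - 2^-1 * omega a (hx p - a))).
split=> [|[[b r] [c s]]].
  split=> //=; case: p ao => x t /= ao.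
  by rewrite heis_mulE /= addrC subrK; congr Heis; ring.
case=> -[/= bU ->] co; rewrite heis_mulE /= => pE.
rewrite pE /= add0r in ao *.
have ab : a = b.
  have dU : b - a \in U by rewrite memvB.
  apply/esym/eqP; rewrite -subr_eq0; apply/eqP/dot_eq0.
  have := ao _ dU; have := co _ dU => /=.
  rewrite -addrA (addrC c) addrA dotC (dotC _ (_ + c)) dotDl => ->.
  by rewrite addr0.
by rewrite ab addrC addKr addrK.
Qed.

(* The unit pair is only the dummy default of [xget]: the decomposition always
   exists and is unique. *)
Definition projV (p : heis) : heis := (xget (1%g, 1%g) (decomp p)).1.
Definition projW (p : heis) : heis := (xget (1%g, 1%g) (decomp p)).2.

Lemma projP p : [/\ hsub (projV p), vsub (projW p) & p = (projV p * projW p)%g].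
Proof.
have [vw [vwp _]] := decomp_exists_unique p.
exact: (xgetI (1%g, 1%g) vwp).
Qed.

Lemma proj_unique p v w : hsub v -> vsub w -> p = (v * w)%g ->
  projV p = v /\ projW p = w.
Proof.
move=> Vv Ww pE; have [vw [_ uniq]] := decomp_exists_unique p.
have [e1 e2 e3] := projP p.
have E1 := uniq (projV p, projW p) (And3 e1 e2 e3).
by have := uniq (v, w) (And3 Vv Ww pE); rewrite E1 => -[-> ->].
Qed.

(* A map E -> W is a total function whose values outside E are irrelevant. *)
Definition intrinsic_lipschitz (E : set heis) (L : R) (phi : heis -> heis) :=
  let Phi v := (v * phi v)%g in
  forall v v', E v -> E v' ->
    hnorm (projW ((Phi v')^-1 * Phi v)%g)
      <= L * hnorm (projV ((Phi v')^-1 * Phi v)%g).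

End Heisenberg.

Definition lipschitz_extension (R : realType) (n k : nat) (L L' : R) : Prop :=
  forall U : {vspace 'rV[R]_(n + n)}, \dim U = k -> isotropic U ->
  forall (E : set (heis R n)) (phi : heis R n -> heis R n),
    E `<=` hsub U ->
    (forall v, E v -> vsub U (phi v)) ->
    intrinsic_lipschitz U E L phi ->
  exists phibar : heis R n -> heis R n,
    [/\ forall v, hsub U v -> vsub U (phibar v),
        forall v, E v -> phibar v = phi v
      & intrinsic_lipschitz U (hsub U) L' phibar].

(* Main.v *)
Require Import Defs.
From mathcomp Require Import all_boot all_order all_algebra.
From mathcomp Require Import all_classical all_reals.
From mathcomp Require Import ring lra.
Set Implicit Arguments.
Unset Strict Implicit.
Unset Printing Implicit Defensive.
Import Order.TTheory GRing.Theory Num.Theory.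
Local Open Scope classical_set_scope.
Local Open Scope ring_scope.

(** A map into the vertical subgroup sends a point [x] of the isotropic subspace
[U] to a direction [w x] orthogonal to [U] and a height [t x]. It is intrinsic
[L]-Lipschitz exactly when [w] is [L]-Lipschitz and, for all points [x] and [y],
the [gap] [t x - t y + omega (x - y) (w y) - omega (w y) (w x) / 2] is at most
[L ^+ 2 * |x - y| ^+ 2] in absolute value ([proj_graph_difference]). Up to the
term quadratic in [w] this says that the pair [(t, w)] is a Whitney jet of class
C^{1,1}, the component of [w] along [J U] being the gradient of [t] up to sign,
where [omega x y = <x, J y>]. The other components of [w] enter only through
[omega (w y) (w x)].

The extension is Whitney's. On the complement of the domain take a partition of
unity [psi] whose functions have second derivatives of the order of the inverse
square of the distance to the domain ([whitney_partition]), and average the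
directions and the tangent planes of nearby points of the domain. The averaged
direction is not yet right: to first order the gap between the averaged graph
points over [x] and [x + h] is [<h, c>] for some vector [c]. Since [U] is
isotropic, [J U] is orthogonal to [U], and since [omega] pairs it trivially with
the vectors orthogonal to [U], adding to the direction a vector of [J U] that
represents [c] cancels this term and leaves all others unchanged
([gap_taylor]). This is where the form of the subgroup is used: there is room in
[J U] for all derivatives along [U].

Both bounds are then computed after a left translation of the group that moves a
nearby point of the domain to the origin: in these coordinates the averaged
heights are of second order and the averaged directions of first order in the
distance to the domain ([gap_avg], [avg_corr_recenter]). The averaged height
contains no quadratic term, because the average of [omega w' (w y)] with the
weights that define the averaged direction [w'] is [omega w' w' = 0]. At limit
points of the domain the extension is obtained from [one_point_extension], and pairs of points far apart compared with their distance
to the domain are chained through points of the domain ([gclose_chain]).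

In the first Heisenberg group the form vanishes on the line orthogonal to [U],
so the conditions are linear in the jet; moreover the gap bound alone shows that
[w] is Lipschitz with constant [2 * L ^+ 2] ([line_dir_bound]). Rescaling to
constant one gives bounds for the direction and for the gap that are both
multiples of [L ^+ 2]. *)

(** * Euclidean geometry of row vectors *)

Section EuclideanNorm.
Variables (R : realType) (m : nat).
Implicit Types x y z : 'rV[R]_m.

Lemma dotDr x y z : dot x (y + z) = dot x y + dot x z.
Proof. by rewrite dotC dotDl !(dotC x). Qed.

Lemma dotZl a x y : dot (a *: x) y = a * dot x y.
Proof. by rewrite mulr_sumr; apply: eq_bigr => i _; rewrite mxE mulrA. Qed.

Lemma dotZr a x y : dot x (a *: y) = a * dot x y.
Proof. by rewrite dotC dotZl dotC. Qed.

Lemma dotNr x y : dot x (- y) = - dot x y.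
Proof. by rewrite dotC dotNl dotC. Qed.

Lemma dot0l x : dot 0 x = 0.
Proof. by rewrite -[0](scale0r x) dotZl mul0r. Qed.

Lemma dot0r x : dot x 0 = 0.
Proof. by rewrite dotC dot0l. Qed.

Lemma dot_suml (I : Type) (s : seq I) (f : I -> 'rV[R]_m) y :
  dot (\sum_(i <- s) f i) y = \sum_(i <- s) dot (f i) y.
Proof. by elim/big_rec2: _ => [|i a b _ <-]; rewrite ?dot0l ?dotDl. Qed.

Lemma dot_ge0 x : 0 <= dot x x.
Proof. by apply: sumr_ge0 => i _; rewrite -expr2 sqr_ge0. Qed.

Lemma enorm_ge0 x : 0 <= enorm x.
Proof. exact: sqrtr_ge0. Qed.

Lemma enorm_sqr x : enorm x ^+ 2 = dot x x.
Proof. by rewrite sqr_sqrtr // dot_ge0. Qed.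

Lemma enorm0 : enorm (0 : 'rV[R]_m) = 0.
Proof. by rewrite /enorm dot0l sqrtr0. Qed.

Lemma enorm0_eq0 x : enorm x = 0 -> x = 0.
Proof. by move=> x0; apply: dot_eq0; rewrite -enorm_sqr x0 expr0n. Qed.

Lemma enormN x : enorm (- x) = enorm x.
Proof. by rewrite /enorm dotNl dotNr opprK. Qed.

Lemma enormBC x y : enorm (x - y) = enorm (y - x).
Proof. by rewrite -enormN opprB. Qed.

Lemma enormZ a x : enorm (a *: x) = `|a| * enorm x.
Proof. by rewrite /enorm dotZl dotZr mulrA -expr2 sqrtrM ?sqr_ge0 // sqrtr_sqr. Qed.

Lemma cauchy_schwarz x y : `|dot x y| <= enorm x * enorm y.
Proof.
rewrite -(ler_pXn2r (n := 2)) ?nnegrE ?mulr_ge0 ?enorm_ge0 //.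
rewrite exprMn !enorm_sqr real_normK ?num_real //.
have [y0|y0] := eqVneq (dot y y) 0.
  by rewrite (dot_eq0 y0) !dot0r mulr0 expr0n.
have yp : 0 < dot y y by rewrite lt_def y0 dot_ge0.
have := dot_ge0 (dot y y *: x - dot x y *: y).
rewrite !(dotDl, dotDr, dotNl, dotNr, dotZl, dotZr) (dotC y x) => H.
rewrite -subr_ge0 -(pmulr_rge0 _ yp); move: H; congr (_ <= _); ring.
Qed.

Lemma enormD x y : enorm (x + y) <= enorm x + enorm y.
Proof.
rewrite -(ler_pXn2r (n := 2)) ?nnegrE ?addr_ge0 ?enorm_ge0 //.
rewrite sqrrD !enorm_sqr dotDl !dotDr (dotC y x).
have := le_trans (ler_norm _) (cauchy_schwarz x y); lra.
Qed.

Lemma enormB x y : enorm (x - y) <= enorm x + enorm y.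
Proof. by rewrite -(enormN y) enormD. Qed.

Lemma enorm_trans y x z : enorm (x - z) <= enorm (x - y) + enorm (y - z).
Proof. by apply: le_trans (enormD _ _); rewrite addrA subrK. Qed.

Lemma enorm_sum (I : Type) (s : seq I) (f : I -> 'rV[R]_m) :
  enorm (\sum_(i <- s) f i) <= \sum_(i <- s) enorm (f i).
Proof.
elim/big_rec2: _ => [|i a b _ ab]; first by rewrite enorm0.
by apply: le_trans (enormD _ _) _; rewrite lerD2l.
Qed.

Lemma coord_le_enorm x i : `|x 0 i| <= enorm x.
Proof.
rewrite -(ler_pXn2r (n := 2)) ?nnegrE ?enorm_ge0 // enorm_sqr real_normK ?num_real //.
rewrite /dot (bigD1 i) //= -expr2 lerDl.
by apply: sumr_ge0 => j _; rewrite -expr2 sqr_ge0.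
Qed.

Lemma enorm_le_coord x a : 0 <= a -> (forall i, `|x 0 i| <= a) ->
  enorm x <= m%:R * a.
Proof.
move=> a0 xa; rewrite -(ler_pXn2r (n := 2)) ?nnegrE ?mulr_ge0 ?enorm_ge0 ?ler0n //.
rewrite enorm_sqr; apply: (@le_trans _ _ (\sum_(i < m) a ^+ 2)).
  apply: ler_sum => i _; rewrite -expr2 -[_ ^+ 2]real_normK ?num_real //.
  by rewrite ler_pXn2r ?nnegrE ?(xa i).
rewrite sumr_const card_ord exprMn -(mulr_natl (a ^+ 2)) ler_wpM2r ?sqr_ge0 //.
case: {+}m => [|m']; first by rewrite expr0n.
by rewrite expr2 ler_peMl // ?ler0n // ler1n.
Qed.

Lemma enorm_orth x y : dot x y = 0 -> enorm y <= enorm (x + y).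
Proof.
move=> xy; rewrite -(ler_pXn2r (n := 2)) ?nnegrE ?enorm_ge0 // !enorm_sqr.
by rewrite dotDl !dotDr (dotC y x) xy; have := dot_ge0 x; lra.
Qed.

End EuclideanNorm.

(** * Whitney points of the complement of a set *)

Section Distance.
Variables (R : realType) (m : nat).
Implicit Types (X : set 'rV[R]_m) (x y p q : 'rV[R]_m).

Definition dist_to X x : R := inf [set enorm (x - p) | p in X].

Variables (X : set 'rV[R]_m) (X0 : X !=set0).

Lemma dist_to_le x p : X p -> dist_to X x <= enorm (x - p).
Proof.
move=> Xp; apply: ge_inf; last by exists p.
by exists 0 => _ [q _ <-]; exact: enorm_ge0.
Qed.

Lemma dist_to_ge0 x : 0 <= dist_to X x.
Proof.
apply: lb_le_inf; first by case: X0 => p Xp; exists (enorm (x - p)), p.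
by move=> _ [q _ <-]; exact: enorm_ge0.
Qed.

Lemma dist_to_near x e : 0 < e -> exists2 p, X p & enorm (x - p) < dist_to X x + e.
Proof.
move=> e0; have [] := @inf_adherent _ [set enorm (x - p) | p in X] _ e0.
  split; first by case: X0 => p Xp; exists (enorm (x - p)), p.
  by exists 0 => _ [q _ <-]; exact: enorm_ge0.
by move=> _ [p Xp <-] lt; exists p.
Qed.

Lemma dist_to_lip x y : dist_to X x <= dist_to X y + enorm (x - y).
Proof.
apply/ler_addgt0Pr => e e0; have [p Xp yp] := dist_to_near y e0.
have := dist_to_le x Xp; have := enorm_trans y x p; lra.
Qed.

End Distance.

Section WhitneyPoints.
Variables (R : realType) (m : nat) (X : set 'rV[R]_m) (X0 : X !=set0).
Local Notation d := (dist_to X).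
Implicit Types x y q : 'rV[R]_m.

(** A maximal disjoint family of balls of radius one tenth of the distance to
[X]: disjointness separates the centres, and maximality forces every other such
ball to meet one of the family, so that the balls of radius a quarter of the
distance cover. *)
Lemma whitney_points : exists Q : set 'rV[R]_m,
  [/\ forall q, Q q -> 0 < d q,
      forall x, 0 < d x -> exists2 q, Q q & enorm (x - q) <= d q / 4%:R
    & forall q q', Q q -> Q q' -> q != q' -> d q / 10%:R <= enorm (q - q')].
Proof.
pose B q := [set y | enorm (y - q) < d q / 10%:R].
have [Q [QD Qtriv Qmax]] := ex_maximal_disjoint_subcollection B [set q | 0 < d q].
have Bq q : 0 < d q -> B q q by move=> dq; rewrite /B /= subrr enorm0; lra.
exists Q; split=> [q /QD //|x dx|q q' Qq Qq' qq'].
- have [[q [Qq [y [xy qy]]]]|nQ] := pselect (exists q, Q q /\ B x `&` B q !=set0).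
    exists q => //; rewrite /B /= in xy qy.
    have := enorm_trans y x q; have := dist_to_lip X0 x q.
    by rewrite (enormBC x y); lra.
  exfalso; apply: (Qmax (Q `|` [set x])).
  + split; first by move=> q; left.
    move=> /(_ x (or_intror erefl)) Qx; apply: nQ; exists x; split=> //.
    by exists x; split; exact: Bq.
  + by move=> q [/QD //|->].
  + move=> q q' [Qq|->] [Qq'|->] // ne.
    * exact: Qtriv.
    * by exfalso; apply: nQ; exists q; rewrite setIC.
    * by exfalso; apply: nQ; exists q'.
- rewrite leNgt; apply/negP => lt; move/negP: qq'; apply; apply/eqP.
  apply: (Qtriv _ _ Qq Qq'); exists q'; split; last exact/Bq/QD.
  by rewrite /B /= enormBC.
Qed.

Variable Q : set 'rV[R]_m.
Hypothesis Qsep :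
  forall q q', Q q -> Q q' -> q != q' -> d q / 10%:R <= enorm (q - q').

Definition whitney_near x q := [/\ Q q, d x / 2%:R <= d q, d q <= 5%:R / 2%:R * d x
  & enorm (q - x) <= 3%:R / 2%:R * d x].

(* Near points are [d x / 20] apart, so cells of side [d x / K] hold at most one. *)
Let K := (20 * m).+1.
Definition whitney_bound := #|{ffun 'I_m -> 'I_(4 * K).+1}|.

(** Whitney points near [x] are separated by a fixed fraction of [d x], so a
grid whose mesh is a smaller fraction puts them into different cells. *)
Lemma whitney_near_finite x : 0 < d x -> exists s : seq 'rV[R]_m,
  [/\ uniq s, (size s <= whitney_bound)%N & forall q, q \in s <-> whitney_near x q].
Proof.
move=> dx.
pose scaled q i : R := K%:R * ((q - x) 0 i / d x + 2%:R).
pose cell q := [ffun i : 'I_m => inord (Num.truncn (scaled q i)) : 'I_(4 * K).+1].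
have K0 : 0 < K%:R :> R by rewrite ltr0n.
have scaledP q i : whitney_near x q -> 0 <= scaled q i < (4 * K).+1%:R.
  move=> [_ _ _ qx]; have := coord_le_enorm (q - x) i; rewrite ler_norml => c.
  have b : - 2%:R <= (q - x) 0 i / d x <= 2%:R.
    by rewrite ler_pdivlMr // ler_pdivrMr //; move: c; lra.
  apply/andP; split; first by apply: mulr_ge0; lra.
  by rewrite /scaled -(@natr1 R (4 * K)) (natrM _ 4 K); nra.
have cell_inj q q' : whitney_near x q -> whitney_near x q' ->
    cell q = cell q' -> q = q'.
  move=> nq nq' e; apply/eqP; apply: contraT => ne.
  have close i : `|(q - q') 0 i| <= d x / K%:R.
    have /andP[a0 a1] := scaledP q i nq; have /andP[b0 b1] := scaledP q' i nq'.
    have lt (r : R) : 0 <= r -> r < (4 * K).+1%:R -> (Num.truncn r < (4 * K).+1)%N.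
      by move=> r0 r1; rewrite -(ltr_nat R); apply: le_lt_trans r1; rewrite truncn_le.
    have := congr1 (fun f : {ffun 'I_m -> 'I_(4 * K).+1} => val (f i)) e.
    rewrite !ffunE /= !inordK ?lt // => et.
    have := truncn_itv a0; have := truncn_itv b0; rewrite et /scaled.
    set t := Num.truncn _; rewrite -(@natr1 R t) => /andP[h1 h2] /andP[h3 h4].
    have -> : (q - q') 0 i = d x * ((q - x) 0 i / d x - (q' - x) 0 i / d x).
      by rewrite !mxE; field; rewrite gt_eqF.
    rewrite normrM gtr0_norm // ler_pM2l // -[X in _ <= X]mul1r ler_pdivlMr //.
    by rewrite -[X in _ * X](gtr0_norm K0) -normrM ler_norml; apply/andP; split; lra.
  have [Qq h1 _ _] := nq; have [Qq' _ _ _] := nq'.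
  have := Qsep Qq Qq' ne.
  have c0 : 0 <= d x / K%:R by apply: divr_ge0; lra.
  have := enorm_le_coord c0 close.
  have -> : m%:R * (d x / K%:R) = d x * (m%:R / K%:R) by ring.
  have : m%:R / K%:R < 1 / 20%:R :> R.
    by rewrite ltr_pdivrMr // /K -(@natr1 R (20 * m)) (natrM _ 20 m); lra.
  by rewrite -(ltr_pM2l dx); lra.
pose rep c := xget 0 [set q | whitney_near x q /\ cell q = c].
exists [seq q <- undup [seq rep c | c <- enum {ffun 'I_m -> 'I_(4 * K).+1}]
       | `[< whitney_near x q >]].
split.
- exact/filter_uniq/undup_uniq.
- rewrite size_filter; apply: leq_trans (count_size _ _) _.
  by apply: leq_trans (size_undup _) _; rewrite size_map -cardE.
- move=> q; rewrite mem_filter mem_undup; split=> [/andP[/asboolP //]|nq].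
  apply/andP; split; first exact/asboolP.
  apply/mapP; exists (cell q); first by rewrite mem_enum.
  have [nr er] := xgetI (P := [set q' | whitney_near x q' /\ cell q' = cell q]) 0
    (conj nq erefl).
  exact/esym/cell_inj.
Qed.

End WhitneyPoints.

(** * A partition of unity subordinate to the Whitney points *)

Section BumpFunction.
Variables (R : realType) (m : nat).
Implicit Types x y q h : 'rV[R]_m.

Definition hat (s : R) := Num.max 0 (1 - s).

Lemma hat01 s : 0 <= s -> 0 <= hat s <= 1.
Proof. by move=> s0; rewrite /hat le_max lexx ge_max /=; lra. Qed.

Lemma hat_lip s t : `|hat t - hat s| <= `|t - s|.
Proof.
have := ler_norm (t - s); have := ler_norm (s - t).
by rewrite distrC ler_norml /hat; case: (leP 0 (1 - t)); case: (leP 0 (1 - s)); lra.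
Qed.

Lemma hat_sqr_taylor s t :
  `|hat t ^+ 2 - hat s ^+ 2 + 2%:R * hat s * (t - s)| <= 2%:R * (t - s) ^+ 2.
Proof.
rewrite /hat ler_norml !expr2; have := sqr_ge0 (t - s); rewrite expr2.
by case: (leP 0 (1 - t)); case: (leP 0 (1 - s)) => ? ? ?; apply/andP; split; nra.
Qed.

Definition ball_bump q (r : R) x := hat (enorm (x - q) ^+ 2 / r ^+ 2) ^+ 2.

Definition ball_bump_grad q (r : R) x :=
  - (4%:R * hat (enorm (x - q) ^+ 2 / r ^+ 2) / r ^+ 2) *: (x - q).

Lemma ball_bump01 q r x : 0 <= ball_bump q r x <= 1.
Proof.
rewrite sqr_ge0 /= expr_le1 //; have /hat01/andP[//] :
  0 <= enorm (x - q) ^+ 2 / r ^+ 2 by rewrite divr_ge0 ?sqr_ge0.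
Qed.

Lemma hat_support q r x : 0 < r -> r <= enorm (x - q) ->
  hat (enorm (x - q) ^+ 2 / r ^+ 2) = 0.
Proof.
move=> r0 rx; apply/max_l; rewrite subr_le0 ler_pdivlMr ?exprn_gt0 // mul1r.
by rewrite ler_pXn2r ?nnegrE ?enorm_ge0 // ltW.
Qed.

(** The bump is a truncated quadratic squared, hence has Lipschitz gradient;
the bounds are stated at the scale [d] of its radius, with [e] the size of the
increment in that scale. *)
Lemma ball_bump_jet q r x h d e : 0 < d -> d / 4%:R <= r ->
    enorm (x - q) <= 3%:R / 2%:R * d -> enorm h = e * d -> e <= 1 / 4%:R ->
  [/\ enorm (ball_bump_grad q r x) <= 10000%:R / d,
      enorm (ball_bump_grad q r (x + h) - ball_bump_grad q r x) <= 10000%:R * e / d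
    & `|ball_bump q r (x + h) - ball_bump q r x - dot (ball_bump_grad q r x) h|
        <= 10000%:R * e ^+ 2].
Proof.
move=> d0 dr zd hE e4; have r0 : 0 < r by lra.
have e0 : 0 <= e by have := enorm_ge0 h; rewrite hE pmulr_lge0.
set z := x - q in zd *.
have -> : ball_bump q r (x + h) = hat (enorm (z + h) ^+ 2 / r ^+ 2) ^+ 2.
  by rewrite /ball_bump addrAC.
have -> : ball_bump_grad q r (x + h)
  = - (4%:R * hat (enorm (z + h) ^+ 2 / r ^+ 2) / r ^+ 2) *: (z + h).
  by rewrite /ball_bump_grad addrAC.
rewrite /ball_bump /ball_bump_grad -/z; clearbody z.
set s := enorm z ^+ 2 / r ^+ 2; set s' := enorm (z + h) ^+ 2 / r ^+ 2.
have rd : (r ^+ 2)^-1 <= 16%:R / d ^+ 2.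
  rewrite -[16%:R]invrK -invfM lef_pV2 ?posrE ?exprn_gt0 ?mulr_gt0 ?invr_gt0 ?exprn_gt0 //.
  by nra.
have r2 : 0 < (r ^+ 2)^-1 by rewrite invr_gt0 exprn_gt0.
have s'E : s' - s = (2%:R * dot z h + enorm h ^+ 2) / r ^+ 2.
  rewrite /s' /s -mulrBl !enorm_sqr dotDl !dotDr (dotC h z).
  by congr (_ / _); ring.
have zh : `|dot z h| <= 3%:R / 2%:R * e * d ^+ 2.
  apply: le_trans (cauchy_schwarz _ _) _; rewrite hE.
  by have := ler_wpM2r (mulr_ge0 e0 (ltW d0)) zd; lra.
(* The inner product contributes 2 * 3 / 2 * 16 and the square 1 / 4 * 16. *)
have ds : `|s' - s| <= 52%:R * e.
  rewrite s'E normrM (gtr0_norm r2) -ler_pdivlMr // invrK.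
  apply: (@le_trans _ _ (13%:R / 4%:R * e * d ^+ 2)).
    rewrite hE; move: zh; rewrite !ler_norml => /andP[z1 z2].
    have : e ^+ 2 * d ^+ 2 <= e / 4%:R * d ^+ 2.
      by rewrite ler_wpM2r ?sqr_ge0 // expr2; nra.
    have : 0 <= e ^+ 2 * d ^+ 2 by rewrite mulr_ge0 ?sqr_ge0.
    by rewrite exprMn => ? ?; apply/andP; split; lra.
  have : d ^+ 2 <= 16%:R * r ^+ 2 by nra.
  by move/(ler_wpM2l e0); lra.
have /andP[m0 m1] : 0 <= hat s <= 1 by rewrite hat01 // divr_ge0 ?sqr_ge0.
have /andP[m0' m1'] : 0 <= hat s' <= 1 by rewrite hat01 // divr_ge0 ?sqr_ge0.
have dV : 0 < d^-1 by rewrite invr_gt0.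
have dVd : d^-1 * d = 1 by rewrite mulVf // gt_eqF.
split.
- rewrite enormZ normrN ger0_norm; last by rewrite !mulr_ge0 ?invr_ge0 ?sqr_ge0.
  apply: (@le_trans _ _ (64%:R / d ^+ 2 * (3%:R / 2%:R * d))).
    apply: ler_pM; rewrite ?enorm_ge0 ?zd //.
      by rewrite !mulr_ge0 ?invr_ge0 ?sqr_ge0.
    by rewrite -/s; nra.
  have -> : 64%:R / d ^+ 2 * (3%:R / 2%:R * d) = 96%:R / d.
    by field; rewrite gt_eqF.
  by lra.
- have -> : - (4%:R * hat s' / r ^+ 2) *: (z + h) - - (4%:R * hat s / r ^+ 2) *: z
     = - (4%:R / r ^+ 2) *: ((hat s' - hat s) *: (z + h) + hat s *: h).
    by apply/rowP => i; rewrite !mxE; ring.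
  rewrite enormZ normrN ger0_norm; last by rewrite !mulr_ge0 ?invr_ge0 ?sqr_ge0.
  apply: (@le_trans _ _ (64%:R / d ^+ 2 * (92%:R * e * d))).
    apply: ler_pM; rewrite ?enorm_ge0 //.
    + by rewrite !mulr_ge0 ?invr_ge0 ?sqr_ge0.
    + by lra.
    apply: le_trans (enormD _ _) _; rewrite !enormZ (ger0_norm m0) hE.
    have z'd : enorm (z + h) <= 7%:R / 4%:R * d.
      apply: le_trans (enormD _ _) _; rewrite hE.
      by have := ler_wpM2r (ltW d0) e4; lra.
    have := ler_pM (normr_ge0 _) (enorm_ge0 _)
       (le_trans (hat_lip s s') ds) z'd.
    have := ler_wpM2r (mulr_ge0 e0 (ltW d0)) m1.
    by lra.
  have -> : 64%:R / d ^+ 2 * (92%:R * e * d) = 5888%:R * e / d.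
    by field; rewrite gt_eqF.
  by have := mulr_ge0 e0 (ltW dV); lra.
- have -> : hat s' ^+ 2 - hat s ^+ 2 - dot (- (4%:R * hat s / r ^+ 2) *: z) h
    = (hat s' ^+ 2 - hat s ^+ 2 + 2%:R * hat s * (s' - s))
      - 2%:R * hat s * (enorm h ^+ 2 / r ^+ 2).
    by rewrite s'E dotZl; ring.
  have := hat_sqr_taylor s s'.
  have : (s' - s) ^+ 2 <= (52%:R * e) ^+ 2.
    by rewrite -[(s' - s) ^+ 2]real_normK ?num_real // ler_pXn2r ?nnegrE // mulr_ge0.
  have : 0 <= hat s * (enorm h ^+ 2 / r ^+ 2) <= 16%:R * e ^+ 2.
    have t0 : 0 <= enorm h ^+ 2 / r ^+ 2 by rewrite divr_ge0 ?sqr_ge0.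
    rewrite mulr_ge0 //=; apply: le_trans (ler_wpM2r t0 m1) _.
    rewrite mul1r ler_pdivrMr ?exprn_gt0 // hE exprMn.
    have : d ^+ 2 <= 16%:R * r ^+ 2 by nra.
    by move/(ler_wpM2l (sqr_ge0 e)); lra.
  rewrite exprMn !ler_norml => /andP[? ?] ? /andP[? ?].
  by have := sqr_ge0 e => ?; apply/andP; split; lra.
Qed.

End BumpFunction.

Section Partition.
Variables (R : realType) (m : nat).
Implicit Types x y q h g G : 'rV[R]_m.

(** Dividing by the sum of all bumps keeps the type of the estimates, because
that sum is bounded below: the remainder of [b / S] is that of
[b' - (b / S) * S'], divided by [S'], plus a product of two first-order terms. *)
Lemma quotient_jet (b b' S S' C d e : R) g g' G G' h :
    0 < d -> 0 <= e -> e <= 1 -> enorm h = e * d -> 1 <= C ->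
    0 <= b <= S -> 0 <= b' <= S' -> 1 / 2%:R <= S -> 1 / 2%:R <= S' ->
    enorm g <= C / d -> enorm G <= C / d ->
    enorm (g' - g) <= C * e / d -> enorm (G' - G) <= C * e / d ->
    `|b' - b - dot g h| <= C * e ^+ 2 -> `|S' - S - dot G h| <= C * e ^+ 2 ->
  let gam := S^-1 *: (g - (b / S) *: G) in
  let gam' := S'^-1 *: (g' - (b' / S') *: G') in
  [/\ enorm gam <= 100%:R * C ^+ 3 / d,
      enorm (gam' - gam) <= 100%:R * C ^+ 3 * e / d
    & `|b' / S' - b / S - dot gam h| <= 100%:R * C ^+ 3 * e ^+ 2].
Proof.
move=> d0 e0 e1 hE C1 /andP[b0 bS] /andP[b0' bS'] S2 S2' gC GC dgC dGC bT ST.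
set p := b / S; set p' := b' / S'; set v := g - p *: G; set v' := g' - p' *: G'.
move=> gam gam'; set i := d^-1.
have Sp : 0 < S by lra.
have Sp' : 0 < S' by lra.
have C0 : 0 <= C by lra.
have i0 : 0 <= i by rewrite invr_ge0 ltW.
have id1 : i * d = 1 by rewrite mulVf // gt_eqF.
have Ci0 : 0 <= C * i by exact: mulr_ge0.
have CC : C <= C ^+ 2 by rewrite expr2 ler_peMr.
have CC3 : C ^+ 2 <= C ^+ 3 by rewrite [leRHS]exprS ler_peMl ?sqr_ge0.
have ee : e ^+ 2 <= e by rewrite expr2 ler_piMr.
have p01 : 0 <= p <= 1 by rewrite divr_ge0 ?(ltW Sp) //= ler_pdivrMr // mul1r.
have p01' : 0 <= p' <= 1 by rewrite divr_ge0 ?(ltW Sp') //= ler_pdivrMr // mul1r.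
have [/andP[p0 p1] /andP[p0' p1']] := (p01, p01').
have iS : 0 <= S^-1 <= 2%:R.
  by rewrite invr_ge0 (ltW Sp) /= -[S^-1]mul1r ler_pdivrMr //; lra.
have iS' : 0 <= S'^-1 <= 2%:R.
  by rewrite invr_ge0 (ltW Sp') /= -[S'^-1]mul1r ler_pdivrMr //; lra.
have [/andP[j0 j2] /andP[j0' j2']] := (iS, iS').
have vC : enorm v <= 2%:R * C * i.
  apply: le_trans (enormB _ _) _; rewrite enormZ ger0_norm //.
  by have := ler_pM p0 (enorm_ge0 _) p1 GC; rewrite -/i in gC *; lra.
have dotb w c : 0 <= c -> enorm w <= c * i -> `|dot w h| <= c * e.
  move=> c0 wc; apply: le_trans (cauchy_schwarz _ _) _; rewrite hE.
  have := ler_wpM2r (mulr_ge0 e0 (ltW d0)) wc.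
  have -> : c * i * (e * d) = c * e * (i * d) by ring.
  by rewrite id1 mulr1.
have dS : `|S' - S| <= 2%:R * C * e.
  have := dotb G C C0 GC; move: ST; rewrite !ler_norml => /andP[? ?] /andP[? ?].
  by have := ler_wpM2l C0 ee => ?; apply/andP; split; lra.
have dj : `|S'^-1 - S^-1| <= 8%:R * C * e.
  have -> : S'^-1 - S^-1 = (S - S') * (S'^-1 * S^-1).
    by field; rewrite !gt_eqF.
  rewrite normrM distrC (ger0_norm (mulr_ge0 j0' j0)).
  have := ler_pM (normr_ge0 _) (mulr_ge0 j0' j0) dS (ler_pM j0' j0 j2' j2).
  by lra.
have gamC : enorm gam <= 4%:R * C * i.
  rewrite enormZ (ger0_norm j0).
  by have := ler_pM j0 (enorm_ge0 _) j2 vC; lra.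
have C2e : C * e <= C ^+ 2 * e by rewrite ler_wpM2r.
have C3e : C ^+ 2 * e <= C ^+ 3 * e by rewrite ler_wpM2r.
have taylor : `|p' - p - dot gam h| <= 20%:R * C ^+ 2 * e ^+ 2.
  have -> : p' - p - dot gam h = dot v h * (S'^-1 - S^-1)
      + ((b' - b - dot g h) - p * (S' - S - dot G h)) * S'^-1.
    rewrite /gam /p' /p /v dotZl dotDl dotNl dotZl /p.
    by field; rewrite !gt_eqF.
  apply: le_trans (ler_normD _ _) _; rewrite !normrM (ger0_norm j0').
  have t1 := ler_pM (normr_ge0 _) (normr_ge0 _)
    (dotb v _ (mulr_ge0 (ler0n _ 2) C0) vC) dj.
  have t2 : `|(b' - b - dot g h) - p * (S' - S - dot G h)| <= 2%:R * C * e ^+ 2.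
    apply: le_trans (ler_normB _ _) _; rewrite normrM (ger0_norm p0).
    by have := ler_pM p0 (normr_ge0 _) p1 ST; lra.
  have t3 := ler_pM (normr_ge0 _) j0' t2 j2'.
  have := ler_wpM2r (sqr_ge0 e) CC.
  by lra.
have dp : `|p' - p| <= 24%:R * C ^+ 2 * e.
  have := dotb gam _ (mulr_ge0 (ler0n _ 4) C0) gamC.
  have := ler_wpM2l (sqr_ge0 C) ee.
  move: taylor; rewrite !ler_norml => /andP[? ?] ? /andP[? ?].
  by apply/andP; split; lra.
split.
- by apply: le_trans gamC _; rewrite -/i; apply: ler_wpM2r => //; lra.
- have -> : gam' - gam = S'^-1 *: (v' - v) + (S'^-1 - S^-1) *: v.
    by apply/rowP => k; rewrite /gam /gam' !mxE; ring.
  have dv : enorm (v' - v) <= 26%:R * C ^+ 3 * e * i.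
    have -> : v' - v = (g' - g) - (p' *: (G' - G) + (p' - p) *: G).
      by apply/rowP => k; rewrite /v /v' !mxE; ring.
    apply: le_trans (enormB _ _) _.
    have := enormD (p' *: (G' - G)) ((p' - p) *: G); rewrite !enormZ (ger0_norm p0').
    have := ler_pM p0' (enorm_ge0 _) p1' dGC.
    have := ler_pM (normr_ge0 _) (enorm_ge0 _) dp GC.
    have := ler_wpM2r i0 C2e; have := ler_wpM2r i0 C3e.
    by rewrite -/i in dgC *; lra.
  apply: le_trans (enormD _ _) _; rewrite !enormZ (ger0_norm j0').
  have := ler_pM j0' (enorm_ge0 _) j2' dv.
  have := ler_pM (normr_ge0 _) (enorm_ge0 _) dj vC.
  have := ler_wpM2r i0 C3e; rewrite -/i.
  by have := mulr_ge0 (mulr_ge0 (exprn_ge0 3 C0) e0) i0; lra.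
- apply: le_trans taylor _; apply: ler_wpM2r; first exact: sqr_ge0.
  by lra.
Qed.

End Partition.

Lemma big_support_eq (I : eqType) (V : nmodType) (s1 s2 : seq I) (f : I -> V) :
  uniq s1 -> uniq s2 -> (forall i, f i != 0 -> (i \in s1) && (i \in s2)) ->
  \sum_(i <- s1) f i = \sum_(i <- s2) f i.
Proof.
move=> u1 u2 sub.
have filt (s : seq I) : \sum_(i <- s) f i = \sum_(i <- s | f i != 0) f i.
  by rewrite (bigID (fun i => f i != 0)) /= [X in _ + X]big1 ?addr0 // => i /negPn/eqP.
rewrite (filt s1) (filt s2) -(big_filter s1) -(big_filter s2); apply: perm_big.
apply: uniq_perm; rewrite ?filter_uniq // => i; rewrite !mem_filter.
by case: (boolP (f i != 0)) => //= /sub/andP[-> ->].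
Qed.

Section WhitneyPartition.
Variables (R : realType) (m : nat).
Implicit Types (X : set 'rV[R]_m) (x y q : 'rV[R]_m).

(** What a Whitney partition of unity provides around the point [x]: the
function [psi q] has gradient [gam q] and is supported near the point [p q] of
the set, and only the indices in the list [s] matter. The estimates are those
of functions with second derivatives of order [d ^- 2]. *)
Record partition_at (C : R) (psi : 'rV[R]_m -> 'rV[R]_m -> R)
    (gam : 'rV[R]_m -> 'rV[R]_m -> 'rV[R]_m) (p : 'rV[R]_m -> 'rV[R]_m)
    (s : seq 'rV[R]_m) (d : R) x y : Prop := PartitionAt {
  part_psi_supp : forall q, psi q y != 0 -> q \in s;
  part_gam_supp : forall q, gam q y != 0 -> q \in s;
  part_psi_sum : \sum_(q <- s) psi q y = 1;
  part_gam_sum : \sum_(q <- s) gam q y = 0;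
  part_psi01 : forall q, q \in s -> 0 <= psi q y <= 1;
  part_near : forall q, q \in s -> enorm (x - p q) <= 7%:R * d;
  part_gam : forall q, q \in s -> enorm (gam q y) <= C / d;
  part_gam_lip : forall q, q \in s ->
    enorm (gam q y - gam q x) <= C * (enorm (y - x) / d) / d;
  part_taylor : forall q, q \in s ->
    `|psi q y - psi q x - dot (gam q x) (y - x)| <= C * (enorm (y - x) / d) ^+ 2
}.

(** Normalised bumps at the Whitney points, each attached to a nearly closest
point of the set. The list [s x] contains the indices active at every point [y]
of a ball about [x], so that values at [x] and [y] are sums over one list. *)
Lemma whitney_partition : exists2 C : R, 1 <= C & forall X, X !=set0 ->
  exists psi gam p s, [/\ forall q, X (p q),
    forall x, 0 < dist_to X x -> uniq (s x) /\ (size (s x))%:R <= C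
  & forall x y, 0 < dist_to X x -> enorm (y - x) <= dist_to X x / 4%:R ->
      partition_at C psi gam p (s x) (dist_to X x) x y].
Proof.
pose N := (@whitney_bound m).+1.
have N1 : 1 <= N%:R :> R by rewrite ler1n.
have [B BE] : exists B : R, B = 10000%:R by exists 10000%:R.
have B0 : 0 <= B by rewrite BE.
have [C1 C1E] : exists c : R, c = N%:R * B by exists (N%:R * B).
have [D DE] : exists D : R, D = 100%:R * C1 ^+ 3 by exists (100%:R * C1 ^+ 3).
have [C CE] : exists C : R, C = 2%:R * D by exists (2%:R * D).
have C11 : 1 <= C1 by rewrite C1E BE; lra.
have D0 : 0 <= D by rewrite DE mulr_ge0 // exprn_ge0 // (le_trans ler01).
have C1C : C1 <= C.
  have : C1 <= C1 ^+ 3 by rewrite ler_eXnr.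
  by lra.
have DC (a : R) : 0 <= a -> D * a <= C * a.
  by move=> a0; rewrite ler_wpM2r //; lra.
exists C => [|X X0]; first by lra.
have NC : N%:R <= C by apply: le_trans C1C; rewrite C1E BE; lra.
have [Q [Qpos Qcov Qsep]] := whitney_points X0.
pose d := dist_to X.
have near_ex x : exists s : seq 'rV[R]_m, 0 < d x ->
    [/\ uniq s, (size s <= N)%N & forall q, q \in s <-> whitney_near X Q x q].
  have [dx|_] := ltP 0 (d x); last by exists [::].
  have [s [us ss sP]] := whitney_near_finite Qsep dx.
  by exists s => _; split=> //; exact: leqW.
have [s sP] := choice near_ex.
have p_ex q : exists p, X p /\ (0 < d q -> enorm (q - p) <= 2%:R * d q).
  have [dq|_] := ltP 0 (d q); last by case: X0 => p Xp; exists p.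
  have [p Xp qp] := dist_to_near X0 q dq.
  by exists p; split=> // _; rewrite /d in dq *; lra.
have [p pP] := choice p_ex.
pose beta q x := if `[< Q q >] then ball_bump q (d q / 2%:R) x else 0.
pose g q x := if `[< Q q >] then ball_bump_grad q (d q / 2%:R) x else 0.
pose S x := \sum_(q <- s x) beta q x.
pose G x := \sum_(q <- s x) g q x.
pose psi q x := beta q x / S x.
pose gam q x := (S x)^-1 *: (g q x - psi q x *: G x).
have beta01 q x : 0 <= beta q x <= 1.
  by rewrite /beta; case: ifP => _; rewrite ?ball_bump01 ?lexx ?ler01.
have active x y q : 0 < d x -> enorm (y - x) <= d x / 4%:R -> Q q ->
    enorm (y - q) < d q / 2%:R -> q \in s x.
  move=> dx yx Qq yq; have [_ _ ->] := sP x dx; split=> //.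
  - have := dist_to_lip X0 x q; have := enorm_trans y x q.
    by rewrite (enormBC x y) -/(d x) -/(d q); lra.
  - have := dist_to_lip X0 q x; have := enorm_trans y q x.
    by rewrite (enormBC q y) -/(d x) -/(d q); lra.
  - have := dist_to_lip X0 q x; have := enorm_trans y q x.
    by rewrite (enormBC q y) -/(d x) -/(d q); lra.
have beta_active x y q : 0 < d x -> enorm (y - x) <= d x / 4%:R ->
    beta q y != 0 \/ g q y != 0 -> q \in s x.
  move=> dx yx; rewrite /beta /g; case: ifP => [/asboolP Qq|_]; last by case=> /eqP.
  move=> ne; apply: (active x y) => //; rewrite ltNge; apply/negP => le.
  have r0 : 0 < d q / 2%:R by have := Qpos q Qq; rewrite -/(d q); lra.
  case: ne => /eqP; apply; rewrite /ball_bump /ball_bump_grad hat_support //.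
    by rewrite expr0n.
  by rewrite mulr0 mul0r oppr0 scale0r.
have dy_pos x y : 0 < d x -> enorm (y - x) <= d x / 4%:R -> 0 < d y.
  move=> dx yx; have := dist_to_lip X0 x y.
  by rewrite (enormBC x y) -/(d x) -/(d y); lra.
have self x : 0 < d x -> enorm (x - x) <= d x / 4%:R.
  by move=> dx; rewrite subrr enorm0; lra.
have same (V : nmodType) (f : 'rV[R]_m -> V) x y : 0 < d x ->
    enorm (y - x) <= d x / 4%:R ->
    (forall q, f q != 0 -> beta q y != 0 \/ g q y != 0) ->
    \sum_(q <- s y) f q = \sum_(q <- s x) f q.
  move=> dx yx fP; have dy := dy_pos x y dx yx.
  have [us _ _] := sP x dx; have [us' _ _] := sP y dy.
  by apply: big_support_eq => // q /fP fq;
    rewrite !(beta_active _ y q) // self.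
have SE x y : 0 < d x -> enorm (y - x) <= d x / 4%:R ->
    S y = \sum_(q <- s x) beta q y.
  by move=> dx yx; apply: same => // q; left.
have GE x y : 0 < d x -> enorm (y - x) <= d x / 4%:R ->
    G y = \sum_(q <- s x) g q y.
  by move=> dx yx; apply: same => // q; right.
have sum_ge (t : seq 'rV[R]_m) y q : q \in t -> beta q y <= \sum_(q <- t) beta q y.
  elim: t => //= a t IH; rewrite inE big_cons => /orP[/eqP ->|/IH qt].
    by rewrite lerDl sumr_ge0 // => i _; case/andP: (beta01 i y).
  by apply: le_trans qt _; rewrite lerDr; case/andP: (beta01 a y).
have S2 x : 0 < d x -> 1 / 2%:R <= S x.
  move=> dx; have [q Qq xq] := Qcov x dx.
  have dq := Qpos q Qq.
  have qs : q \in s x by apply: (active x x) => //; rewrite ?self //; lra.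
  apply: le_trans (sum_ge _ _ _ qs); rewrite /beta asboolT // /ball_bump.
  set a := enorm _ ^+ 2 / _; have a4 : a <= 1 / 4%:R.
    rewrite /a ler_pdivrMr ?exprn_gt0 ?divr_gt0 //.
    have -> : 1 / 4%:R * (d q / 2%:R) ^+ 2 = (d q / 4%:R) ^+ 2 by field.
    by rewrite ler_pXn2r ?nnegrE ?enorm_ge0 // divr_ge0 // ltW.
  have h : 3%:R / 4%:R <= hat a by rewrite /hat le_max; apply/orP; right; lra.
  by rewrite expr2; nra.
exists psi, gam, p, s; split.
- by move=> q; case: (pP q).
- move=> x dx; have [us ss _] := sP x dx; split=> //.
  by apply: le_trans NC; rewrite ler_nat.
move=> x y dx yx; rewrite -/(d x) in dx yx *.
have [us ss inP] := sP x dx; have dy := dy_pos x y dx yx.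
have Sy := S2 y dy; have Sx := S2 x dx.
have Sy0 : 0 < S y by apply: lt_le_trans Sy; rewrite divr_gt0.
have Syn0 : S y != 0 by rewrite gt_eqF.
have [e eE] : exists e, e = enorm (y - x) / d x by eexists.
have e0 : 0 <= e by rewrite eE divr_ge0 ?enorm_ge0 // ltW.
have e4 : e <= 1 / 4%:R by rewrite eE ler_pdivrMr //; lra.
have e1 : e <= 1 by apply: le_trans e4 _; rewrite ler_pdivrMr // mul1r ler1n.
have hE : enorm (y - x) = e * d x by rewrite eE divfK // gt_eqF.
have sumN (f : 'rV[R]_m -> R) a : (forall q, q \in s x -> f q <= B * a) -> 0 <= a ->
    \sum_(q <- s x) f q <= C1 * a.
  move=> fa a0; apply: (@le_trans _ _ (\sum_(q <- s x) B * a)).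
    by rewrite big_seq [leRHS]big_seq; apply: ler_sum.
  rewrite big_const_seq count_predT iter_addr_0 -(mulr_natl (B * a)) C1E -mulrA.
  by apply: ler_wpM2r; rewrite ?ler_nat // mulr_ge0.
have jet q : q \in s x -> [/\ enorm (g q x) <= B / d x,
      enorm (g q y - g q x) <= B * e / d x
    & `|beta q y - beta q x - dot (g q x) (y - x)| <= B * e ^+ 2].
  move=> /inP[Qq h1 h2 h3]; rewrite /g /beta asboolT //.
  rewrite -[in ball_bump_grad q _ y](subrKC x y) -[in ball_bump q _ y](subrKC x y).
  rewrite BE; apply: ball_bump_jet => //; first by rewrite -/(d x) -/(d q) in h1; lra.
  by rewrite enormBC.
have Gx : enorm (G x) <= C1 / d x.
  rewrite (GE x x) ?self //; apply: le_trans (enorm_sum _ _) _.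
  by apply: sumN => [q /jet[]|] //; rewrite invr_ge0 ltW.
have dG : enorm (G y - G x) <= C1 * e / d x.
  have -> : G y - G x = \sum_(q <- s x) (g q y - g q x).
    by rewrite sumrB -(GE x y) // -(GE x x) ?self.
  apply: le_trans (enorm_sum _ _) _.
  rewrite -mulrA; apply: sumN => [q /jet[]|]; first by rewrite -mulrA.
  by rewrite divr_ge0 // ltW.
have dS : `|S y - S x - dot (G x) (y - x)| <= C1 * e ^+ 2.
  rewrite (SE x y) // (SE x x) ?self // (GE x x) ?self // dot_suml -!sumrB.
  apply: le_trans (ler_norm_sum _ _ _) _.
  by apply: sumN => [q /jet[]|] //; rewrite sqr_ge0.
have C1u (a : R) : 0 <= a -> B * a <= C1 * a.
  by move=> a0; rewrite ler_wpM2r // C1E BE; lra.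
have quot q : q \in s x -> [/\ enorm (gam q x) <= D / d x,
      enorm (gam q y - gam q x) <= D * e / d x
    & `|psi q y - psi q x - dot (gam q x) (y - x)| <= D * e ^+ 2].
  move=> qs; have [j1 j2 j3] := jet q qs.
  rewrite DE; apply: (quotient_jet dx e0 _ hE C11) => //.
  - by have /andP[-> _] := beta01 q x; rewrite (SE x x) ?self // sum_ge.
  - by have /andP[-> _] := beta01 q y; rewrite (SE x y) // sum_ge.
  - by apply: le_trans j1 _; apply: C1u; rewrite invr_ge0 ltW.
  - apply: le_trans j2 _; rewrite -!mulrA; apply: C1u.
    by rewrite divr_ge0 // ltW.
  - by apply: le_trans j3 _; apply: C1u; rewrite sqr_ge0.
have psi_beta q z : psi q z != 0 -> beta q z != 0.
  by apply: contraNneq => b0; rewrite /psi b0 mul0r.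
have gam_active q z : gam q z != 0 -> beta q z != 0 \/ g q z != 0.
  move=> gn; have [b0|] := eqVneq (beta q z) 0; last by left.
  right; apply: contraNneq gn => g0.
  by rewrite /gam /psi b0 g0 mul0r scale0r subr0 scaler0.
split; rewrite -?eE.
- by move=> q /psi_beta b; apply: (beta_active x y) => //; left.
- by move=> q /gam_active; apply: beta_active.
- by rewrite /psi -mulr_suml -(SE x y) // divff.
- rewrite /gam -scaler_sumr sumrB -(GE x y) // -scaler_suml /psi -mulr_suml.
  by rewrite -(SE x y) // divff // scale1r subrr scaler0.
- move=> q qs; have /andP[b0 _] := beta01 q y.
  by rewrite /psi divr_ge0 ?(ltW Sy0) //= ler_pdivrMr // mul1r (SE x y) // sum_ge.
(* 3 / 2 from [x] to [q], and twice 5 / 2 from [q] to [p q]. *)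
- move=> q /inP[Qq h1 h2 h3]; have [_ /(_ (Qpos q Qq))] := pP q.
  have := enorm_trans q x (p q); rewrite (enormBC x q) -/(d x) -/(d q) in h1 h2 h3 *.
  lra.
- move=> q /quot[j1 j2 _]; rewrite -[gam q y](subrKC (gam q x)).
  apply: le_trans (enormD _ _) _; rewrite CE mulr_natl mulr2n mulrDl lerD //.
  apply: le_trans j2 _; by rewrite ler_pM2r ?invr_gt0 // ler_piMr.
- move=> q /quot[_ j2 _]; apply: le_trans j2 _; rewrite -!mulrA; apply: DC.
  by rewrite divr_ge0 // ltW.
- by move=> q /quot[_ _ j3]; apply: le_trans j3 _; apply: DC; rewrite sqr_ge0.
Qed.

End WhitneyPartition.

(** * The symplectic form and graph points *)

Section Symplectic.
Variables (R : realType) (n : nat).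
Local Notation V := 'rV[R]_(n + n).
Implicit Types (x y z w u h : V).

(** The standard complex structure, for which [omega] is the Euclidean product
of one argument with the image of the other. *)
Definition symJ x : V := row_mx (rsubmx x) (- lsubmx x).

Lemma omega_dot x y : omega x y = dot x (symJ y).
Proof.
rewrite /dot big_split_ord /= -big_split /=; apply: eq_bigr => i _.
by rewrite row_mxEl row_mxEr !mxE; ring.
Qed.

Lemma dot_symJ x y : dot (symJ x) (symJ y) = dot x y.
Proof.
rewrite /dot !big_split_ord /= addrC; congr (_ + _); apply: eq_bigr => i _.
  by rewrite !row_mxEr !mxE; ring.
by rewrite !row_mxEl !mxE.
Qed.

Lemma symJB x y : symJ x - symJ y = symJ (x - y).
Proof.
apply/rowP => i; rewrite !mxE.
by case: (fintype.split i) => j; rewrite !mxE; ring.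
Qed.

Lemma symJK x : symJ (symJ x) = - x.
Proof.
apply/rowP => i; rewrite !mxE; case: split_ordP => j ->; rewrite !mxE.
  by rewrite -[rshift n j]/(unsplit (inr j)) unsplitK !mxE.
by rewrite -[lshift n j]/(unsplit (inl j)) unsplitK !mxE.
Qed.

Lemma enorm_symJ x : enorm (symJ x) = enorm x.
Proof. by rewrite /enorm dot_symJ. Qed.

Lemma omega_le x y : `|omega x y| <= enorm x * enorm y.
Proof. by rewrite omega_dot -(enorm_symJ y) cauchy_schwarz. Qed.

Lemma omega_le_bound x y a b : enorm x <= a -> enorm y <= b -> `|omega x y| <= a * b.
Proof.
by move=> xa yb; apply: le_trans (omega_le _ _) _; apply: ler_pM; rewrite ?enorm_ge0.
Qed.

Lemma omega_anti x y : omega x y = - omega y x.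
Proof. by rewrite /omega -sumrN; apply: eq_bigr => i _; ring. Qed.

Lemma omegaZr a x y : omega x (a *: y) = a * omega x y.
Proof. by rewrite /omega mulr_sumr; apply: eq_bigr => i _; rewrite !mxE; ring. Qed.

Lemma omegaZl a x y : omega (a *: x) y = a * omega x y.
Proof. by rewrite omega_anti omegaZr (omega_anti y); ring. Qed.

Lemma omega0r x : omega x 0 = 0.
Proof. by rewrite -(scale0r 0) omegaZr mul0r. Qed.

Lemma omega_sumr (I : Type) (s : seq I) x (f : I -> V) :
  omega x (\sum_(i <- s) f i) = \sum_(i <- s) omega x (f i).
Proof. by elim/big_rec2: _ => [|i a b _ <-]; rewrite ?omega0r ?omegaDr. Qed.

Definition perp (U : {vspace V}) w := forall u, u \in U -> dot u w = 0.

Section Perp.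
Variable U : {vspace V}.

Lemma perpD w w' : perp U w -> perp U w' -> perp U (w + w').
Proof. by move=> pw pw' u uU; rewrite dotDr pw ?pw' ?addr0. Qed.

Lemma perpZ a w : perp U w -> perp U (a *: w).
Proof. by move=> pw u uU; rewrite dotZr pw ?mulr0. Qed.

Lemma perpB w w' : perp U w -> perp U w' -> perp U (w - w').
Proof. by move=> pw pw'; rewrite -scaleN1r; apply/perpD/perpZ. Qed.

Lemma perp_sum (I : eqType) (s : seq I) (f : I -> V) :
  (forall i, i \in s -> perp U (f i)) -> perp U (\sum_(i <- s) f i).
Proof.
move=> pf; rewrite big_seq; apply: (big_ind (perp U)) => //; last exact: perpD.
by move=> u _; rewrite dot0r.
Qed.

Lemma orth_proj_exists : exists f : V -> V, forall x, f x \in U /\ perp U (x - f x).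
Proof.
have ex x : exists a, a \in U /\ perp U (x - a).
  by have [a aU ao] := orth_decomp U x; exists a.
by have [f fP] := choice ex; exists f.
Qed.

Hypothesis iso : isotropic U.

Lemma perp_symJ x : x \in U -> perp U (symJ x).
Proof. by move=> xU u uU; rewrite -omega_dot; apply: iso. Qed.

Lemma omega_symJ_perp x w : x \in U -> perp U w -> omega w (symJ x) = 0.
Proof. by move=> xU pw; rewrite omega_dot symJK dotNr dotC pw ?oppr0. Qed.

End Perp.

(** The point of an intrinsic graph that lies over [base] in the horizontal
subgroup, the value there having components [dir] and [height]. *)
Record gpoint := GPoint { base : V; dir : V; height : R }.
Implicit Types a b c : gpoint.

(** The vertical component of the projection of [b^-1 a] to the complementary
subgroup. *)
Definition gap a b :=
  height a - height b + omega (base a - base b) (dir b) - 2^-1 * omega (dir b) (dir a).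

Lemma gap_sym a b :
  gap b a = omega (base a - base b) (dir b - dir a) - gap a b.
Proof.
rewrite /gap !(omegaDl, omegaDr, omegaNl, omegaNr) (omega_anti (dir b) (dir a)).
by ring.
Qed.

Lemma gap_trans b a c : gap a c = gap a b + gap b c
  - omega (base a - base b) (dir b - dir c)
  + 2^-1 * omega (dir b - dir c) (dir a - dir b).
Proof.
rewrite /gap !(omegaDl, omegaDr, omegaNl, omegaNr) !omegaxx (omega_anti (dir c) (dir b)).
by ring.
Qed.

(** A quasi-distance between graph points, comparable with that of the group:
it is symmetric and satisfies the triangle inequality up to constants, because
the correction terms of [gap_sym] and [gap_trans] are products of two
differences of first order. *)
Definition gclose (K r : R) a b :=
  [/\ enorm (base a - base b) <= K * r, enorm (dir a - dir b) <= K * r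
    & `|gap a b| <= K * r ^+ 2].

Lemma gclose_weaken K K' r r' a b : 0 <= K <= K' -> 0 <= r <= r' ->
  gclose K r a b -> gclose K' r' a b.
Proof.
move=> /andP[K0 KK'] /andP[r0 rr'] [h1 h2 h3].
have Kr : K * r <= K' * r' by apply: ler_pM.
by split; [exact: le_trans Kr|exact: le_trans Kr|apply: le_trans h3 _; apply: ler_pM;
  rewrite ?sqr_ge0 // ler_pXn2r ?nnegrE //; apply: le_trans rr'].
Qed.

Lemma gclose_sym K r a b : 1 <= K -> 0 <= r ->
  gclose K r a b -> gclose (2%:R * K ^+ 2) r b a.
Proof.
move=> K1 r0 [h1 h2 h3].
have KK : K <= K ^+ 2 by rewrite expr2 ler_peMr //; lra.
have le : K * r <= 2%:R * K ^+ 2 * r by apply: ler_wpM2r => //; lra.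
split; [by rewrite enormBC; lra|by rewrite enormBC; lra|rewrite gap_sym].
apply: le_trans (ler_normB _ _) _; rewrite enormBC in h2.
have := omega_le_bound h1 h2.
have := ler_wpM2r (sqr_ge0 r) KK; rewrite -expr2 exprMn; lra.
Qed.

Lemma gclose_trans K r b a c : 1 <= K -> 0 <= r ->
  gclose K r a b -> gclose K r b c -> gclose (4%:R * K ^+ 2) r a c.
Proof.
move=> K1 r0 [h1 h2 h3] [k1 k2 k3].
have KK : K <= K ^+ 2 by rewrite expr2 ler_peMr //; lra.
have le := ler_wpM2r r0 KK; have Kr : 0 <= K ^+ 2 * r by rewrite mulr_ge0 ?sqr_ge0.
split.
- by have := enorm_trans (base b) (base a) (base c); lra.
- by have := enorm_trans (dir b) (dir a) (dir c); lra.
have o1 := omega_le_bound h1 k2; have o2 := omega_le_bound k2 h2.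
have := ler_wpM2r (sqr_ge0 r) KK.
have : 0 <= K ^+ 2 * r ^+ 2 by rewrite mulr_ge0 ?sqr_ge0.
move: o1 o2 h3 k3; rewrite (gap_trans b a c) -!expr2 exprMn !ler_norml.
by do 4 move=> /andP[? ?]; move=> ? ?; apply/andP; split; lra.
Qed.

(** The orientation of the last link is the one in which the endpoint is
compared with a point of the set. *)
Lemma gclose_chain K : 1 <= K -> exists2 K', K <= K' &
  forall r a b c d, 0 <= r -> gclose K r a b -> gclose K r b c -> gclose K r d c ->
    gclose K' r a d.
Proof.
move=> K1; have [K2 K2E] : exists k : R, k = 2%:R * K ^+ 2 by eexists.
have KK2 : K <= K2 by rewrite K2E expr2; nra.
have [K3 K3E] : exists k : R, k = 4%:R * K2 ^+ 2 by eexists.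
have K23 : K2 <= K3 by rewrite K3E expr2; nra.
exists (4%:R * K3 ^+ 2) => [|r a b c d r0 ab bc dc]; first by rewrite expr2; nra.
have r00 : 0 <= r <= r by rewrite r0 lexx.
have K21 : 1 <= K2 := le_trans K1 KK2.
have K31 : 1 <= K3 := le_trans K21 K23.
have w2 (g g' : gpoint) : gclose K r g g' -> gclose K2 r g g'.
  by apply: gclose_weaken => //; rewrite KK2 (le_trans ler01).
have w3 (g g' : gpoint) : gclose K2 r g g' -> gclose K3 r g g'.
  by apply: gclose_weaken => //; rewrite K23 (le_trans ler01).
have ac : gclose K3 r a c by rewrite K3E; exact: (gclose_trans K21 r0 (w2 _ _ ab) (w2 _ _ bc)).
have cd : gclose K3 r c d by apply: w3; rewrite K2E; exact: gclose_sym.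
exact: gclose_trans K31 r0 ac cd.
Qed.

End Symplectic.

(** * Extension by one point *)

Section OnePoint.
Variable R : realType.

(** The supremum of the lower bounds [f p - g p], all of which lie below all
the upper bounds. *)
Lemma mcshane_point (T : Type) (X : set T) (f g : T -> R) : X !=set0 ->
  (forall p p', X p -> X p' -> f p - f p' <= g p + g p') ->
  exists a, forall p, X p -> `|a - f p| <= g p.
Proof.
move=> [p0 Xp0] fg; exists (sup [set f p - g p | p in X]) => p Xp.
have ub p' : X p' -> ubound [set f p - g p | p in X] (f p' + g p').
  by move=> Xp' _ [q Xq <-]; have := fg q p' Xq Xp'; lra.
have h1 : sup [set f p - g p | p in X] <= f p + g p.
  by apply: ge_sup; [exists (f p0 - g p0), p0|exact: ub].
have h2 : f p - g p <= sup [set f p - g p | p in X].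
  by apply: ub_le_sup; [exists (f p0 + g p0); exact: ub|exists p].
by rewrite ler_norml; apply/andP; split; lra.
Qed.

Variables (n : nat).
Local Notation V := 'rV[R]_(n + n).

(** An intrinsic [L]-Lipschitz map is the case [A = L], [B = L ^+ 2]; without that
relation the class of jets is stable under scalars when the form vanishes on
the directions. *)
Definition jet_data (U : {vspace V}) (A B : R) (X : set V) (w : V -> V) (t : V -> R) :=
  [/\ forall p, X p -> perp U (w p),
      forall p p', X p -> X p' -> enorm (w p - w p') <= A * enorm (p - p')
    & forall p p', X p -> X p' ->
        `|gap (GPoint p (w p) (t p)) (GPoint p' (w p') (t p'))|
          <= B * enorm (p - p') ^+ 2].

(** Used at the points at distance zero from [X], where the Whitney construction is not
available. The direction is extended by coordinates and projected; then the
prescribed gaps to the points of [X] leave compatible intervals for the height,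
by [gap_trans]. *)
Lemma one_point_extension (A : R) : 1 <= A -> exists2 C, 0 <= C &
  forall (U : {vspace V}) X w t, X !=set0 -> jet_data U A A X w t ->
  forall x, exists wx tx, perp U wx /\ forall p, X p ->
    enorm (wx - w p) <= C * enorm (x - p) /\
    `|gap (GPoint x wx tx) (GPoint p (w p) (t p))| <= C * enorm (x - p) ^+ 2.
Proof.
move=> A1; have [K KE] : exists K : R, K = (n + n)%:R * A by eexists.
have K0 : 0 <= K by rewrite KE mulr_ge0 // ; lra.
have AK : 0 <= A * K by rewrite mulr_ge0 //; lra.
exists (4%:R * A + A * K + K); first by lra.
move=> U X w t X0 [wP wL gL] x.
have coord i : exists a, forall p, X p -> `|a - w p 0 i| <= A * enorm (x - p).
  apply: mcshane_point => // p p' Xp Xp'.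
  have := coord_le_enorm (w p - w p') i; rewrite !mxE ler_norml => /andP[_ h].
  have := wL p p' Xp Xp'; have := enorm_trans x p p'; rewrite (enormBC p x).
  move=> tr; have := ler_wpM2l (le_trans ler01 A1) tr; lra.
have [a aP] := choice coord; pose wr : V := \row_i a i.
have wrP p : X p -> enorm (wr - w p) <= K * enorm (x - p).
  move=> Xp; rewrite KE -mulrA; apply: enorm_le_coord => [|i].
    by rewrite mulr_ge0 ?enorm_ge0 //; lra.
  by rewrite !mxE; exact: aP.
clearbody wr; have [b bU bP] := orth_decomp U wr.
have wxP p : X p -> enorm (wr - b - w p) <= K * enorm (x - p).
  move=> Xp; apply: le_trans (wrP p Xp).
  have -> : wr - w p = b + (wr - b - w p) by rewrite addrA subrKC.
  apply: enorm_orth.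
  exact: (perpB bP (wP p Xp)).
set wx := wr - b in bP wxP *; clearbody wx.
pose f p := - gap (GPoint x wx 0) (GPoint p (w p) (t p)).
have [tx txP] : exists tx, forall p, X p ->
    `|tx - f p| <= (4%:R * A + A * K) * enorm (x - p) ^+ 2.
  apply: mcshane_point => // p p' Xp Xp'.
  have := gap_trans (GPoint p (w p) (t p)) (GPoint x wx 0) (GPoint p' (w p') (t p')).
  rewrite /f /=; set u := enorm (x - p); set v := enorm (x - p').
  have u0 : 0 <= u := enorm_ge0 _; have v0 : 0 <= v := enorm_ge0 _.
  have uv : enorm (p - p') <= u + v by rewrite /u (enormBC x p) enorm_trans.
  have A0 : 0 <= A by lra.
  have wuv : enorm (w p - w p') <= A * (u + v).
    by apply: le_trans (wL p p' Xp Xp') _; rewrite ler_wpM2l.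
  have o1 := omega_le_bound (lexx u) wuv.
  have o2 := omega_le_bound wuv (wxP p Xp).
  have g1 : A * enorm (p - p') ^+ 2 <= A * (u + v) ^+ 2.
    by rewrite ler_wpM2l // ler_pXn2r ?nnegrE ?enorm_ge0 ?addr_ge0.
  have g2 := gL p p' Xp Xp'.
  have s1 : A * (u + v) ^+ 2 <= 2%:R * A * (u ^+ 2 + v ^+ 2).
    by have := mulr_ge0 A0 (sqr_ge0 (u - v)); rewrite !expr2; lra.
  have s2 : A * (u * (u + v)) <= 2%:R * A * (u ^+ 2 + v ^+ 2).
    have := mulr_ge0 A0 (sqr_ge0 (u - v)); have := mulr_ge0 A0 (sqr_ge0 u).
    by have := mulr_ge0 A0 (sqr_ge0 v); rewrite !expr2; lra.
  have s3 : A * K * (u * (u + v)) <= 2%:R * (A * K) * (u ^+ 2 + v ^+ 2).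
    have := mulr_ge0 AK (sqr_ge0 (u - v)); have := mulr_ge0 AK (sqr_ge0 u).
    by have := mulr_ge0 AK (sqr_ge0 v); rewrite !expr2; lra.
  move: o1 o2 g2; rewrite -/u !ler_norml => /andP[? ?] /andP[? ?] /andP[? ?] ->.
  by lra.
exists wx, tx; split=> // p Xp; split.
  apply: le_trans (wxP p Xp) _; apply: ler_wpM2r; rewrite ?enorm_ge0 //; lra.
have -> : gap (GPoint x wx tx) (GPoint p (w p) (t p)) = tx - f p.
  by rewrite /f /gap /=; ring.
by apply: le_trans (txP p Xp) _; apply: ler_wpM2r; rewrite ?sqr_ge0 //; lra.
Qed.

End OnePoint.

(** * Averaging graph points with a partition of unity *)

Lemma eq_ler (R : numDomainType) (x y : R) : x = y -> x <= y.
Proof. by move->. Qed.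

Section Perp2.
Variables (R : realType) (n : nat) (U : {vspace 'rV[R]_(n + n)}).
Hypothesis iso : isotropic U.
Local Notation V := 'rV[R]_(n + n).

(** The symplectic form does not see components in [J U] of vectors orthogonal
to [U], which is why adding such a component adjusts first derivatives freely. *)
Lemma omega_perp_symJ (a b c c' : V) : perp U a -> perp U b -> c \in U -> c' \in U ->
  omega (a + symJ c) (b + symJ c') = omega a b.
Proof.
move=> pa pb cU cU'; rewrite omegaDl !omegaDr (omega_symJ_perp cU' pa).
rewrite (omega_anti (symJ c) b) (omega_symJ_perp cU pb) (omega_symJ_perp cU') ?oppr0 ?addr0 //.
exact: perp_symJ.
Qed.

Lemma orth_proj_lip (pr : V -> V) : (forall x, pr x \in U /\ perp U (x - pr x)) ->
  forall x y, enorm (pr x - pr y) <= enorm (x - y).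
Proof.
move=> prP x y; have [xU xo] := prP x; have [yU yo] := prP y.
have -> : x - y = ((x - pr x) - (y - pr y)) + (pr x - pr y).
  by apply/rowP => i; rewrite !mxE; ring.
by apply: enorm_orth; rewrite dotC; apply: (perpB xo yo); rewrite memvB.
Qed.

End Perp2.

Section Average.
Variables (R : realType) (n : nat) (I : eqType) (s : seq I).
Local Notation V := 'rV[R]_(n + n).
Variables (P W : I -> V) (T : I -> R) (o : gpoint R n).
Implicit Types (psi : I -> R) (gam : I -> V) (z : V).

Definition avg_dir psi : V := \sum_(q <- s) psi q *: W q.

(** The summands are the heights above [z] of the tangent planes at the points
[P q]. *)
Definition avg_height psi z : R :=
  \sum_(q <- s) psi q * (T q - omega (z - P q) (W q)).

(** To first order, the gap from the averaged graph point over [z] to the one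
over [z + h] is the product of this vector with [h]; it comes from the
variation [gam] of the weights alone. *)
Definition avg_corr psi gam z : V :=
  \sum_(q <- s) (T q - omega (z - P q) (W q) - 2^-1 * omega (avg_dir psi) (W q)) *: gam q.

Let e q := W q - dir o.
Let tau q := gap (GPoint (P q) (W q) (T q)) o.

Definition avg_coef psi z q :=
  tau q - omega (z - P q) (e q) - 2^-1 * omega (avg_dir psi - dir o) (e q).

Lemma avg_dir_recenter psi : \sum_(q <- s) psi q = 1 ->
  avg_dir psi - dir o = \sum_(q <- s) psi q *: e q.
Proof.
move=> psi1; rewrite -[dir o in LHS]scale1r -psi1 scaler_suml -sumrB.
by apply: eq_bigr => q _; rewrite scalerBr.
Qed.

(** Left translating the point [o] to the origin, the averaged height is an
average of quantities that are small of second order. *)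
Lemma gap_avg psi z w : \sum_(q <- s) psi q = 1 ->
  omega (dir o) w = omega (dir o) (avg_dir psi) ->
  gap (GPoint z w (avg_height psi z)) o
    = \sum_(q <- s) psi q * (tau q - omega (z - P q) (e q)).
Proof.
move=> psi1 wE; rewrite /gap /= wE omega_sumr.
have -> : avg_height psi z - height o + omega (z - base o) (dir o)
  = avg_height psi z + \sum_(q <- s) psi q * (omega (z - base o) (dir o) - height o).
  by rewrite -mulr_suml psi1; ring.
rewrite mulr_sumr -big_split /= -sumrB; apply: eq_bigr => q _.
rewrite /tau /e /gap /= omegaZr !(omegaDl, omegaDr, omegaNl, omegaNr).
by ring.
Qed.

(** The gradients of the weights sum to zero, so a quantity independent of the
index may be subtracted; what remains has coefficients of second order. *)
Lemma avg_corr_recenter psi gam z : \sum_(q <- s) gam q = 0 ->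
  avg_corr psi gam z = \sum_(q <- s) avg_coef psi z q *: gam q.
Proof.
move=> gam0.
have E q : T q - omega (z - P q) (W q) - 2^-1 * omega (avg_dir psi) (W q)
  = avg_coef psi z q + (height o - omega (z - base o) (dir o)
                        - 2^-1 * omega (avg_dir psi) (dir o)).
  rewrite /avg_coef /tau /e /gap /= !(omegaDl, omegaDr, omegaNl, omegaNr) omegaxx.
  by ring.
rewrite /avg_corr (eq_bigr _ (fun q _ => congr1 ( *:%R^~ (gam q)) (E q))).
rewrite (eq_bigr _ (fun q _ => scalerDl _ _ _)) big_split /= -scaler_sumr gam0.
by rewrite scaler0 addr0.
Qed.

End Average.

Section LocalEstimates.
Variables (R : realType) (n : nat) (I : eqType) (s : seq I).
Local Notation V := 'rV[R]_(n + n).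
Variables (P W : I -> V) (T : I -> R) (o : gpoint R n) (C A d : R) (x : V).
Hypotheses (C1 : 1 <= C) (A1 : 1 <= A) (d0 : 0 < d) (size_s : (size s)%:R <= C).
Hypothesis near : forall q, q \in s -> enorm (x - P q) <= 7%:R * d.
Hypothesis near_o : enorm (x - base o) <= 2%:R * d.
Hypothesis dir_data : forall q, q \in s ->
  enorm (W q - dir o) <= A * enorm (P q - base o).
Hypothesis gap_data : forall q, q \in s ->
  `|gap (GPoint (P q) (W q) (T q)) o| <= A * enorm (P q - base o) ^+ 2.

Local Notation e q := (W q - dir o).
Local Notation tau q := (gap (GPoint (P q) (W q) (T q)) o).
Local Notation adir := (avg_dir s W).
Local Notation acorr := (avg_corr s P W T).
Local Notation acoef := (avg_coef s P W T o).

Let C0 : 0 <= C. Proof. exact: le_trans ler01 C1. Qed.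
Let A0 : 0 <= A. Proof. exact: le_trans ler01 A1. Qed.
Let d_ge0 : 0 <= d. Proof. exact: ltW. Qed.

Lemma size_sum_le (f : I -> R) a : 0 <= a -> (forall q, q \in s -> f q <= a) ->
  \sum_(q <- s) f q <= C * a.
Proof.
move=> a0 fa; apply: (@le_trans _ _ (\sum_(q <- s) a)).
  by rewrite big_seq [leRHS]big_seq; apply: ler_sum.
by rewrite big_const_seq count_predT iter_addr_0 -(mulr_natl a) ler_wpM2r.
Qed.

Lemma size_norm_sum_le (f : I -> R) a : 0 <= a -> (forall q, q \in s -> `|f q| <= a) ->
  `|\sum_(q <- s) f q| <= C * a.
Proof. by move=> a0 fa; apply: le_trans (ler_norm_sum _ _ _) _; apply: size_sum_le. Qed.

Lemma size_enorm_sum_le (f : I -> V) a : 0 <= a ->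
  (forall q, q \in s -> enorm (f q) <= a) -> enorm (\sum_(q <- s) f q) <= C * a.
Proof. by move=> a0 fa; apply: le_trans (enorm_sum _ _) _; apply: size_sum_le. Qed.

Lemma dist_o q : q \in s -> enorm (P q - base o) <= 9%:R * d.
Proof.
by move=> qs; have := enorm_trans x (P q) (base o); rewrite (enormBC (P q) x);
  have := near_o; have := near qs; lra.
Qed.

Lemma dir_o_le q : q \in s -> enorm (e q) <= 9%:R * A * d.
Proof.
move=> qs; apply: le_trans (dir_data qs) _.
by have := ler_wpM2l A0 (dist_o qs); lra.
Qed.

Lemma tau_le q : q \in s -> `|tau q| <= 81%:R * A * d ^+ 2.
Proof.
move=> qs; apply: le_trans (gap_data qs) _.
have -> : 81%:R * A * d ^+ 2 = A * (9%:R * d) ^+ 2 by ring.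
by rewrite ler_wpM2l // ler_pXn2r ?nnegrE ?enorm_ge0 ?mulr_ge0 // dist_o.
Qed.

Section OnePsi.
Variables (psi : I -> R) (gam : I -> V) (z : V).
Hypothesis psi1 : \sum_(q <- s) psi q = 1.
Hypothesis gam0 : \sum_(q <- s) gam q = 0.
Hypothesis psi01 : forall q, q \in s -> 0 <= psi q <= 1.
Hypothesis gam_le : forall q, q \in s -> enorm (gam q) <= C / d.
Hypothesis zx : enorm (z - x) <= d / 4%:R.

Lemma avg_dir_le : enorm (adir psi - dir o) <= C * (9%:R * A) * d.
Proof.
rewrite (avg_dir_recenter _ _ psi1) -mulrA; apply: size_enorm_sum_le => [|q qs].
  by rewrite !mulr_ge0.
have /andP[p0 p1] := psi01 qs; rewrite enormZ ger0_norm //.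
by apply: le_trans (dir_o_le qs); rewrite ler_piMl ?enorm_ge0.
Qed.

Lemma height_term_le q : q \in s ->
  `|tau q - omega (z - P q) (e q)| <= 153%:R * A * d ^+ 2.
Proof.
move=> qs; apply: le_trans (ler_normB _ _) _.
have zP : enorm (z - P q) <= 8%:R * d.
  by have := enorm_trans x z (P q); have := near qs; have := zx; have := d_ge0; lra.
by have := omega_le_bound zP (dir_o_le qs); have := tau_le qs; lra.
Qed.

Lemma avg_coef_le q : q \in s ->
  `|acoef psi z q| <= (153%:R * A + 41%:R * C * A ^+ 2) * d ^+ 2.
Proof.
move=> qs; apply: le_trans (ler_normB _ _) _; have := height_term_le qs.
have := omega_le_bound avg_dir_le (dir_o_le qs).
have : 0 <= C * A ^+ 2 * d ^+ 2 by rewrite !mulr_ge0 ?sqr_ge0.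
rewrite normrM ger0_norm ?invr_ge0 //.
by have -> : C * (9%:R * A) * d * (9%:R * A * d) = 81%:R * (C * A ^+ 2 * d ^+ 2);
  [ring|lra].
Qed.

Lemma avg_corr_le : enorm (acorr psi gam z)
  <= C * ((153%:R * A + 41%:R * C * A ^+ 2) * C) * d.
Proof.
rewrite (avg_corr_recenter _ _ _ o _ _ gam0) -mulrA.
apply: size_enorm_sum_le => [|q qs].
  by rewrite !mulr_ge0 ?addr_ge0 ?mulr_ge0 ?sqr_ge0.
rewrite enormZ; apply: le_trans (ler_pM _ _ (avg_coef_le qs) (gam_le qs)) _;
  rewrite ?enorm_ge0 //.
by apply: eq_ler; field; rewrite gt_eqF.
Qed.

Lemma gap_avg_le w : omega (dir o) w = omega (dir o) (adir psi) ->
  `|gap (GPoint z w (avg_height s P W T psi z)) o| <= C * (153%:R * A) * d ^+ 2.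
Proof.
move=> wE; rewrite (gap_avg _ _ _ psi1 wE) -mulrA.
apply: size_norm_sum_le => [|q qs]; first by rewrite !mulr_ge0 ?sqr_ge0.
have /andP[p0 p1] := psi01 qs; rewrite normrM ger0_norm //.
by apply: le_trans (height_term_le qs); rewrite ler_piMl.
Qed.

End OnePsi.

Section TwoPsi.
Variables (psi psi' : I -> R) (gam gam' : I -> V) (y : V).
Hypothesis psi1 : \sum_(q <- s) psi q = 1.
Hypothesis gam0 : \sum_(q <- s) gam q = 0.
Hypothesis psi01 : forall q, q \in s -> 0 <= psi q <= 1.
Hypothesis gam_le : forall q, q \in s -> enorm (gam q) <= C / d.
Hypothesis psi1' : \sum_(q <- s) psi' q = 1.
Hypothesis gam0' : \sum_(q <- s) gam' q = 0.
Hypothesis psi01' : forall q, q \in s -> 0 <= psi' q <= 1.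
Hypothesis gam_le' : forall q, q \in s -> enorm (gam' q) <= C / d.
Hypothesis yx : enorm (y - x) <= d / 4%:R.
Hypothesis gam_lip : forall q, q \in s ->
  enorm (gam' q - gam q) <= C * (enorm (y - x) / d) / d.
Hypothesis taylor : forall q, q \in s ->
  `|psi' q - psi q - dot (gam q) (y - x)| <= C * (enorm (y - x) / d) ^+ 2.

Let xx : enorm (x - x) <= d / 4%:R.
Proof. by rewrite subrr enorm0 divr_ge0. Qed.

Let h0 : 0 <= enorm (y - x). Proof. exact: enorm_ge0. Qed.

Lemma psi_lip q : q \in s -> `|psi' q - psi q| <= 2%:R * C * (enorm (y - x) / d).
Proof.
move=> qs; have := taylor qs; have := cauchy_schwarz (gam q) (y - x).
have e0 : 0 <= enorm (y - x) / d by rewrite divr_ge0.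
have e1 : enorm (y - x) / d <= 1.
  by rewrite ler_pdivrMr //; have := yx; have := d_ge0; lra.
have := ler_wpM2r h0 (gam_le qs).
have := ler_wpM2l (mulr_ge0 C0 e0) e1; rewrite mulr1 -mulrA -expr2.
have -> : C / d * enorm (y - x) = C * (enorm (y - x) / d) by ring.
move=> t1 t2; rewrite !ler_norml => /andP[? ?] /andP[? ?].
by apply/andP; split; lra.
Qed.

Lemma avg_dir_diff : adir psi' - adir psi = \sum_(q <- s) (psi' q - psi q) *: e q.
Proof.
rewrite -[LHS](subrKA (dir o)) (avg_dir_recenter _ _ psi1') -opprB.
rewrite (avg_dir_recenter _ _ psi1) -sumrB.
by apply: eq_bigr => q _; rewrite scalerBl.
Qed.

Lemma avg_dir_lip :
  enorm (adir psi' - adir psi) <= C * (2%:R * C * (9%:R * A)) * enorm (y - x).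
Proof.
rewrite avg_dir_diff -mulrA; apply: size_enorm_sum_le => [|q qs]; first by rewrite !mulr_ge0.
rewrite enormZ; apply: le_trans (ler_pM _ _ (psi_lip qs) (dir_o_le qs)) _;
  rewrite ?enorm_ge0 //.
by apply: eq_ler; field; rewrite gt_eqF.
Qed.

Lemma avg_coef_lip q : q \in s -> `|acoef psi' y q - acoef psi x q|
  <= (9%:R * A + 81%:R * C ^+ 2 * A ^+ 2) * d * enorm (y - x).
Proof.
move=> qs.
have -> : acoef psi' y q - acoef psi x q =
  - omega (y - x) (e q) - 2^-1 * omega (adir psi' - adir psi) (e q).
  rewrite /avg_coef !(omegaDl, omegaDr, omegaNl, omegaNr).
  by ring.
apply: le_trans (ler_normB _ _) _.
have := omega_le_bound avg_dir_lip (dir_o_le qs).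
have := omega_le_bound (lexx (enorm (y - x))) (dir_o_le qs).
rewrite normrN normrM [`|2^-1|]ger0_norm ?invr_ge0 //.
by lra.
Qed.

Lemma avg_corr_lip : enorm (acorr psi' gam' y - acorr psi gam x)
  <= C * ((9%:R * A + 81%:R * C ^+ 2 * A ^+ 2) * C
          + (153%:R * A + 41%:R * C * A ^+ 2) * C) * enorm (y - x).
Proof.
rewrite (avg_corr_recenter _ _ _ o _ _ gam0') (avg_corr_recenter _ _ _ o _ _ gam0).
rewrite -sumrB -mulrA; apply: size_enorm_sum_le => [|q qs].
  by rewrite !(mulr_ge0, addr_ge0) ?sqr_ge0.
have -> : acoef psi' y q *: gam' q - acoef psi x q *: gam q
  = (acoef psi' y q - acoef psi x q) *: gam' q + acoef psi x q *: (gam' q - gam q).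
  by apply/rowP => i; rewrite !mxE; ring.
apply: le_trans (enormD _ _) _; rewrite !enormZ [leRHS]mulrDl; apply: lerD.
  apply: le_trans (ler_pM _ _ (avg_coef_lip qs) (gam_le' qs)) _; rewrite ?enorm_ge0 //.
  by apply: eq_ler; field; rewrite gt_eqF.
apply: le_trans (ler_pM _ _ (avg_coef_le psi1 psi01 xx qs) (gam_lip qs)) _;
  rewrite ?enorm_ge0 //.
by apply: eq_ler; field; rewrite gt_eqF.
Qed.

Variable U : {vspace V}.
Hypothesis iso : isotropic U.
Hypothesis W_perp : forall q, q \in s -> perp U (W q).
Hypothesis o_perp : perp U (dir o).

(** The component [c] along [J U] is the one that cancels the first-order term
of the gap: what remains pairs the Taylor remainders of the weights with
second-order coefficients. *)
Lemma gap_taylor (c c' : V) : c \in U -> c' \in U -> y - x \in U ->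
  dot (y - x) c = dot (y - x) (acorr psi gam x) ->
  `|gap (GPoint y (adir psi' + symJ c') (avg_height s P W T psi' y))
        (GPoint x (adir psi + symJ c) (avg_height s P W T psi x))|
  <= (C * ((153%:R * A + 41%:R * C * A ^+ 2) * C) + C * (2%:R * C * (9%:R * A)))
     * enorm (y - x) ^+ 2.
Proof.
move=> cU cU' hU cE.
have pa : perp U (adir psi) by apply: perp_sum => q qs; apply/perpZ/W_perp.
have pa' : perp U (adir psi') by apply: perp_sum => q qs; apply/perpZ/W_perp.
have oE a b : perp U a -> b \in U -> omega (dir o) (a + symJ b) = omega (dir o) a.
  by move=> ua bU; rewrite omegaDr (omega_symJ_perp bU o_perp) addr0.
set a := GPoint y _ _; set b := GPoint x _ _.
have -> : gap a b = \sum_(q <- s) (psi' q - psi q - dot (gam q) (y - x)) * acoef psi x q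
    - omega (y - x) (adir psi' - adir psi).
  have := gap_trans b a o.
  rewrite {1}/a (gap_avg _ _ _ psi1' (oE _ _ pa' cU')).
  rewrite {2}/b (gap_avg _ _ _ psi1 (oE _ _ pa cU)) /a /b /=.
  have -> : adir psi + symJ c - dir o = (adir psi - dir o) + symJ c by rewrite addrAC.
  have -> : adir psi' + symJ c' - (adir psi + symJ c)
      = (adir psi' - adir psi) + symJ (c' - c).
    by rewrite -symJB opprD addrACA.
  have po : perp U (adir psi - dir o) := perpB pa o_perp.
  rewrite (omega_perp_symJ iso po (perpB pa' pa) cU); last by rewrite memvB.
  rewrite [omega (y - x) (_ + symJ c)]omegaDr [omega _ (symJ c)]omega_dot symJK dotNr cE.
  rewrite (avg_corr_recenter _ _ _ o _ _ gam0).
  have -> : dot (y - x) (\sum_(q <- s) acoef psi x q *: gam q)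
      = \sum_(q <- s) dot (gam q) (y - x) * acoef psi x q.
    rewrite dotC dot_suml; apply: eq_bigr => q _.
    by rewrite dotZl mulrC.
  have -> : \sum_(q <- s) psi' q * (tau q - omega (y - P q) (e q)) =
      \sum_(q <- s) psi' q * (tau q - omega (x - P q) (e q))
      - omega (y - x) (adir psi' - dir o).
    rewrite (avg_dir_recenter _ _ psi1') omega_sumr -sumrB; apply: eq_bigr => q _.
    by rewrite omegaZr !(omegaDl, omegaDr, omegaNl, omegaNr); ring.
  have -> : omega (adir psi - dir o) (adir psi' - adir psi)
      = \sum_(q <- s) (psi' q - psi q) * omega (adir psi - dir o) (e q).
    by rewrite avg_dir_diff omega_sumr; apply: eq_bigr => q _; rewrite omegaZr.
  have -> : \sum_(q <- s) (psi' q - psi q - dot (gam q) (y - x)) * acoef psi x q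
    = \sum_(q <- s) psi' q * (tau q - omega (x - P q) (e q))
    - \sum_(q <- s) psi q * (tau q - omega (x - P q) (e q))
    - 2^-1 * \sum_(q <- s) (psi' q - psi q) * omega (adir psi - dir o) (e q)
    - \sum_(q <- s) dot (gam q) (y - x) * acoef psi x q.
    rewrite mulr_sumr -!sumrB; apply: eq_bigr => q _.
    by rewrite /avg_coef; ring.
  have -> : adir psi' - dir o = (adir psi' - adir psi) + (adir psi - dir o).
    by rewrite addrA subrK.
  by rewrite [omega _ (adir psi' - adir psi + _)]omegaDr; lra.
apply: le_trans (ler_normB _ _) _; rewrite mulrDl; apply: lerD; last first.
  by apply: le_trans (omega_le_bound (lexx _) avg_dir_lip) _; apply: eq_ler; ring.
rewrite -mulrA; apply: size_norm_sum_le => [|q qs].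
  by rewrite !(mulr_ge0, addr_ge0) ?sqr_ge0.
rewrite normrM; apply: le_trans (ler_pM _ _ (taylor qs) (avg_coef_le psi1 psi01 xx qs)) _;
  rewrite ?normr_ge0 //.
by apply: eq_ler; field; rewrite gt_eqF.
Qed.

End TwoPsi.
End LocalEstimates.

(** * Extension of jets *)

Section Extension.
Variables (R : realType) (n : nat).
Local Notation V := 'rV[R]_(n + n).
Implicit Types (x y p : V) (X : set V).

Section WhitneyCase.
Variables (C A : R) (U : {vspace V}) (X : set V) (w : V -> V) (t : V -> R).
Variables (psi : V -> V -> R) (gam : V -> V -> V) (p : V -> V) (s : V -> seq V) (pr : V -> V).
Hypotheses (C1 : 1 <= C) (A1 : 1 <= A) (iso : isotropic U) (X0 : X !=set0).
Hypothesis data : jet_data U A A X w t.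
Hypothesis pX : forall q, X (p q).
Hypothesis size_s : forall x, 0 < dist_to X x -> uniq (s x) /\ (size (s x))%:R <= C.
Hypothesis part : forall x y, 0 < dist_to X x -> enorm (y - x) <= dist_to X x / 4%:R ->
  partition_at C psi gam p (s x) (dist_to X x) x y.
Hypothesis prP : forall x, pr x \in U /\ perp U (x - pr x).

Local Notation d := (dist_to X).
Local Notation dp z := (GPoint z (w z) (t z)).

(** The averaged graph, its directions corrected along [J U]. *)
Definition wh_avg x := avg_dir (s x) (w \o p) (psi^~ x).
Definition wh_corr x := avg_corr (s x) p (w \o p) (t \o p) (psi^~ x) (gam^~ x) x.
Definition wh_dir x := wh_avg x + symJ (pr (wh_corr x)).
Definition wh_height x := avg_height (s x) p (w \o p) (t \o p) (psi^~ x) x.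

Let self x : 0 < d x -> enorm (x - x) <= d x / 4%:R.
Proof. by move=> dx; rewrite subrr enorm0 divr_ge0 // ltW. Qed.

Lemma wh_avg_perp x : perp U (wh_avg x).
Proof. by apply: perp_sum => q _; apply/perpZ; case: data => wP _ _; apply: wP. Qed.

Lemma wh_dir_perp x : perp U (wh_dir x).
Proof. by apply: perpD; [exact: wh_avg_perp|apply/perp_symJ => //; case: (prP (wh_corr x))]. Qed.

Lemma wh_near_data x z : 0 < d x -> X z -> enorm (x - z) <= 2%:R * d x ->
  enorm (wh_dir x - w z) <= (C * (9%:R * A)
      + C * ((153%:R * A + 41%:R * C * A ^+ 2) * C)) * d x /\
  `|gap (GPoint x (wh_dir x) (wh_height x)) (dp z)| <= C * (153%:R * A) * d x ^+ 2.
Proof.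
move=> dx Xz xz; have [us ss] := size_s dx; have [wP wL gL] := data.
have [_ _ ps gs p01 pn gl _ _] := part dx (self dx).
have dd q : q \in s x -> enorm (w (p q) - dir (dp z)) <= A * enorm (p q - base (dp z)).
  by move=> _; apply: wL.
have gd q : q \in s x -> `|gap (dp (p q)) (dp z)| <= A * enorm (p q - base (dp z)) ^+ 2.
  by move=> _; apply: gL.
split.
  have -> : wh_dir x - w z = (wh_avg x - w z) + symJ (pr (wh_corr x)) by rewrite addrAC.
  apply: le_trans (enormD _ _) _; rewrite enorm_symJ mulrDl; apply: lerD.
    exact: (avg_dir_le (W := w \o p) (o := dp z) A1 dx ss pn xz dd ps p01).
  have := orth_proj_lip prP (wh_corr x) 0.
  have pr0 : pr 0 = 0.
    by have [p0U p0o] := prP 0; have := p0o _ p0U; rewrite sub0r dotNr => /eqP;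
      rewrite oppr_eq0 => /eqP/dot_eq0.
  rewrite pr0 !subr0 => h; apply: le_trans h _.
  exact: (avg_corr_le (W := w \o p) (T := t \o p) (o := dp z)
    C1 A1 dx ss pn xz dd gd ps gs p01 gl (self dx)).
apply: (gap_avg_le (W := w \o p) (T := t \o p) (o := dp z)
  A1 dx ss pn xz dd gd ps p01 (self dx)).
rewrite /wh_dir omegaDr [omega _ (symJ _)](@omega_symJ_perp _ _ U) ?addr0 //.
  by case: (prP (wh_corr x)).
exact: wP.
Qed.

Lemma wh_near_wh x y : 0 < d x -> enorm (y - x) <= d x / 4%:R -> y - x \in U ->
  enorm (wh_dir y - wh_dir x) <= (C * (2%:R * C * (9%:R * A))
      + C * ((9%:R * A + 81%:R * C ^+ 2 * A ^+ 2) * C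
             + (153%:R * A + 41%:R * C * A ^+ 2) * C)) * enorm (y - x) /\
  `|gap (GPoint y (wh_dir y) (wh_height y)) (GPoint x (wh_dir x) (wh_height x))|
    <= (C * ((153%:R * A + 41%:R * C * A ^+ 2) * C) + C * (2%:R * C * (9%:R * A)))
       * enorm (y - x) ^+ 2.
Proof.
move=> dx yx hU; have [us ss] := size_s dx; have [wP wL gL] := data.
have dy : 0 < d y.
  by have := dist_to_lip X0 x y; rewrite (enormBC x y); lra.
have [us' _] := size_s dy.
have [psi_y gam_y _ _ _ _ _ _ _] := part dy (self dy).
have [_ _ ps gs p01 pn gl _ _] := part dx (self dx).
have [psi_x gam_x ps' gs' p01' _ gl' glip tay] := part dx yx.
have [z Xz xz] := dist_to_near X0 x dx.
have xz2 : enorm (x - base (dp z)) <= 2%:R * d x by rewrite /=; lra.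
have dd q : q \in s x -> enorm (w (p q) - dir (dp z)) <= A * enorm (p q - base (dp z)).
  by move=> _; apply: wL.
have gd q : q \in s x -> `|gap (dp (p q)) (dp z)| <= A * enorm (p q - base (dp z)) ^+ 2.
  by move=> _; apply: gL.
(* The sums defining the extension at [y] may be taken over the list of [x]. *)
have avgE : wh_avg y = avg_dir (s x) (w \o p) (psi^~ y).
  apply: big_support_eq => // q; have [->|qn _] := eqVneq (psi q y) 0.
    by rewrite scale0r eqxx.
  by rewrite psi_x ?psi_y.
have heightE : wh_height y = avg_height (s x) p (w \o p) (t \o p) (psi^~ y) y.
  apply: big_support_eq => // q; have [->|qn _] := eqVneq (psi q y) 0.
    by rewrite mul0r eqxx.
  by rewrite psi_x ?psi_y.
have corrE : wh_corr y = avg_corr (s x) p (w \o p) (t \o p) (psi^~ y) (gam^~ y) y.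
  rewrite /wh_corr /avg_corr -/(wh_avg y) -avgE.
  apply: big_support_eq => // q; have [->|qn _] := eqVneq (gam q y) 0.
    by rewrite scaler0 eqxx.
  by rewrite gam_x ?gam_y.
split.
  have -> : wh_dir y - wh_dir x
    = (wh_avg y - wh_avg x) + symJ (pr (wh_corr y) - pr (wh_corr x)).
    by rewrite -symJB opprD addrACA.
  apply: le_trans (enormD _ _) _; rewrite enorm_symJ mulrDl; apply: lerD.
    rewrite avgE; exact: (avg_dir_lip (W := w \o p) (o := dp z)
      C1 A1 dx ss pn xz2 dd ps gl ps' yx tay).
  apply: le_trans (orth_proj_lip prP _ _) _; rewrite corrE.
  exact: (avg_corr_lip (W := w \o p) (T := t \o p) (o := dp z)
    C1 A1 dx ss pn xz2 dd gd ps gs p01 gl ps' gs' gl' yx glip tay).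
rewrite heightE [wh_dir y]/wh_dir avgE.
apply: (gap_taylor (W := w \o p) (T := t \o p) (o := dp z)
    C1 A1 dx ss pn xz2 dd gd ps gs p01 gl ps' yx tay iso) => //.
- by move=> q _; apply: wP.
- exact: wP.
- by case: (prP (wh_corr x)).
- by case: (prP (wh_corr y)).
- have [_ /(_ _ hU)] := prP (wh_corr x).
  by rewrite dotDr dotNr => /eqP; rewrite subr_eq0 => /eqP <-.
Qed.

End WhitneyCase.

(** Two points much closer to each other than to the set lie in the range of
one list of Whitney indices, and are compared by [wh_near_wh]; otherwise each
is compared with a point of the set nearby, and the comparisons are chained. *)
Lemma jet_extension (A : R) : 1 <= A -> exists2 K, 0 <= K &
  forall (U : {vspace V}), isotropic U -> forall X w t, X `<=` [set x | x \in U] ->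
  jet_data U A A X w t -> exists w' t',
    [/\ forall x, X x -> w' x = w x, forall x, X x -> t' x = t x
      & jet_data U K K [set x | x \in U] w' t'].
Proof.
move=> A1.
have [C C1 part] := whitney_partition R (n + n).
have [C' C'0 onept] := one_point_extension n A1.
have [KB KBE] : exists k : R, k = 153%:R * A + 41%:R * C * A ^+ 2 by eexists.
have [K1 K1E] : exists k : R, k = C * (9%:R * A) + C * (KB * C) by eexists.
have [K2 K2E] : exists k : R, k = C * (153%:R * A) by eexists.
have [K3 K3E] : exists k : R, k = C * (2%:R * C * (9%:R * A))
  + C * ((9%:R * A + 81%:R * C ^+ 2 * A ^+ 2) * C + KB * C) by eexists.
have [K4 K4E] : exists k : R, k = C * (KB * C) + C * (2%:R * C * (9%:R * A)) by eexists.
have C0 : 0 <= C by lra.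
have A0 : 0 <= A by lra.
have KB0 : 0 <= KB by rewrite KBE !(mulr_ge0, addr_ge0) ?sqr_ge0.
have K10 : 0 <= K1 by rewrite K1E !(mulr_ge0, addr_ge0).
have K20 : 0 <= K2 by rewrite K2E !mulr_ge0.
have K30 : 0 <= K3 by rewrite K3E !(mulr_ge0, addr_ge0) ?sqr_ge0.
have K40 : 0 <= K4 by rewrite K4E !(mulr_ge0, addr_ge0).
have [M ME] : exists M, M = A + C' + K1 + K2 + K3 + K4 by eexists.
have M1 : 1 <= M by lra.
have AM : A <= M by lra.
have C'M : C' <= M by lra.
have K1M : K1 <= M by lra.
have K2M : K2 <= M by lra.
have K3M : K3 <= M by lra.
have K4M : K4 <= M by lra.
clear ME.
have [M4 MM4 chain] := gclose_chain n M1.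
have M0 : 0 <= M := le_trans ler01 M1.
have M40 : 0 <= M4 := le_trans M0 MM4.
have KM0 : 0 <= 441%:R * M4 by rewrite mulr_ge0.
have MKM : M <= 441%:R * M4 by lra.
exists (441%:R * M4) => //.
move=> U iso X w t XU data; have [wP wL gL] := data.
have gap0 (a b : gpoint R n) : base a = base b -> dir a = dir b -> height a = height b ->
    gap a b = 0.
  by case: a b => ? ? ? [? ? ?] /= -> -> ->; rewrite /gap /= !subrr omegaxx
    omega_anti omega0r; ring.
have [X0|nX0] := pselect (X !=set0); last first.
  exists (fun=> 0), (fun=> 0); split.
  - by move=> x Xx; exfalso; apply: nX0; exists x.
  - by move=> x Xx; exfalso; apply: nX0; exists x.
  split.
  - by move=> x _ u _; rewrite dot0r.
  - by move=> x y _ _; rewrite subrr enorm0 mulr_ge0 ?enorm_ge0.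
  - move=> x y _ _; rewrite /gap /= !omega0r !mulr0 subrr add0r subrr normr0.
    by rewrite mulr_ge0 ?sqr_ge0.
have [psi [gam [p [s [pX size_s partP]]]]] := part X X0.
have [pr prP] := orth_proj_exists U.
have [w0 w0P] := choice (onept U X w t X0 data).
have [t0 wt0P] := choice w0P.
pose d := dist_to X.
pose w' x := if 0 < d x then wh_dir w t psi gam p s pr x else w0 x.
pose t' x := if 0 < d x then wh_height w t psi p s x else t0 x.
pose g x := GPoint x (w' x) (t' x).
pose dp x := GPoint x (w x) (t x).
have d0 x : 0 <= d x := dist_to_ge0 X0 x.
have anchor x e : 0 < e -> exists z, [/\ X z, enorm (x - z) <= 2%:R * d x + e,
    enorm (w' x - w z) <= M * enorm (x - z)
    & `|gap (g x) (dp z)| <= M * enorm (x - z) ^+ 2].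
  move=> e0; rewrite /g /w' /t'; case: ifPn => dx; last first.
    have [z Xz xz] := dist_to_near X0 x e0; exists z.
    have [h1 h2] := (wt0P x).2 z Xz; split=> //.
    - by apply: le_trans (ltW xz) _; rewrite lerD2r mulr_natl mulr2n lerDl d0.
    - by apply: le_trans h1 _; rewrite ler_wpM2r ?enorm_ge0.
    - by apply: le_trans h2 _; rewrite ler_wpM2r ?sqr_ge0.
  have [z Xz xz] := dist_to_near X0 x dx; exists z; rewrite -/(d x) in xz.
  have xz2 : enorm (x - z) <= 2%:R * d x by rewrite mulr_natl mulr2n ltW.
  have dxz : d x <= enorm (x - z) := dist_to_le x Xz.
  have := wh_near_data C1 A1 data pX size_s partP prP dx Xz xz2.
  rewrite -KBE -K1E -K2E => -[h1 h2]; split=> //; first by rewrite (le_trans xz2) // lerDl ltW.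
  - by apply: le_trans h1 _; rewrite ler_pM // ; lra.
  - by apply: le_trans h2 _; rewrite ler_pM ?sqr_ge0 ?ler_pXn2r ?nnegrE ?enorm_ge0 //; lra.
have interior x y : 0 < d x -> enorm (y - x) <= d x / 4%:R -> y - x \in U ->
    enorm (w' y - w' x) <= M * enorm (y - x) /\
    `|gap (g y) (g x)| <= M * enorm (y - x) ^+ 2.
  move=> dx near hU; have dy : 0 < d y.
    by have := dist_to_lip X0 x y; rewrite (enormBC x y) -/(d x) -/(d y); lra.
  have := wh_near_wh C1 A1 iso X0 data pX size_s partP prP dx near hU.
  rewrite -KBE -K3E -K4E /g /w' /t' dx dy => -[h1 h2]; split.
  - by apply: le_trans h1 _; rewrite ler_wpM2r ?enorm_ge0.
  - by apply: le_trans h2 _; rewrite ler_wpM2r ?sqr_ge0.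
clear KBE K1E K2E K3E K4E KB0 K10 K20 K30 K40 K1M K2M K3M K4M KB K1 K2 K3 K4.
have onX x : X x -> w' x = w x /\ t' x = t x.
  move=> Xx; have dx0 : d x = 0.
    by apply/le_anti; rewrite d0 andbT; have := dist_to_le x Xx; rewrite subrr enorm0.
  rewrite /w' /t' dx0 ltxx; have [_ /(_ x Xx)] := wt0P x.
  rewrite subrr enorm0 expr0n /= !mulr0 => -[h1 h2].
  have wE : w0 x = w x.
    by apply/eqP; rewrite -subr_eq0; apply/eqP/enorm0_eq0/le_anti; rewrite h1 enorm_ge0.
  split=> //; apply/eqP; rewrite -subr_eq0 -normr_le0; move: h2.
  rewrite /gap /= wE subrr omegaxx (omega_anti 0) omega0r.
  by rewrite oppr0 addr0 mulr0 subr0.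
exists w', t'; split; [by move=> x /onX[]|by move=> x /onX[]|].
have pair x y : x \in U -> y \in U ->
    enorm (w' y - w' x) <= 441%:R * M4 * enorm (y - x) /\
    `|gap (g y) (g x)| <= 441%:R * M4 * enorm (y - x) ^+ 2.
  move=> xU yU; have [->|yx] := eqVneq y x.
    by rewrite gap0 // !subrr enorm0 normr0 expr0n !mulr0.
  have r0 : 0 < enorm (y - x).
    by rewrite lt_def enorm_ge0 andbT; apply: contraNneq yx => /enorm0_eq0/eqP;
      rewrite subr_eq0.
  have [near|far] := leP (enorm (y - x)) (d x / 4%:R).
    have dx : 0 < d x by move: (lt_le_trans r0 near); rewrite pmulr_lgt0 ?invr_gt0.
    have [h1 h2] := interior x y dx near (memvB yU xU); split.
    - by apply: le_trans h1 _; rewrite ler_wpM2r ?enorm_ge0.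
    - by apply: le_trans h2 _; rewrite ler_wpM2r ?sqr_ge0.
  set r := enorm (y - x) in r0 far *.
  have dy : d y <= d x + r := dist_to_lip X0 y x.
  clear C1 C0 C'0 A1 C'M KM0 MKM interior.
  have [a [Xa xa wa ga]] := anchor x r r0.
  have [b [Xb yb wb gb]] := anchor y r r0.
  (* As [d x < 4 * r] and [d y < 5 * r], the points [a] and [b] are within 9 r
  and 11 r of [x] and [y]; hence the scale 21 r and the factor 441. *)
  have ba : enorm (b - a) <= 21%:R * r.
    have := enorm_trans y b a; have := enorm_trans x y a.
    by rewrite (enormBC b y) -/r; lra.
  have r21 : 0 <= 21%:R * r by rewrite mulr_ge0 // ltW.
  have scaled k u : 0 <= k <= M -> 0 <= u <= 21%:R * r -> k * u <= M * (21%:R * r) /\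
      k * u ^+ 2 <= M * (21%:R * r) ^+ 2.
    move=> /andP[k0 kM] /andP[u0 ur]; split; apply: ler_pM; rewrite ?sqr_ge0 //.
    by rewrite ler_pXn2r ?nnegrE.
  have M01 : 0 <= M <= M by rewrite M0 lexx.
  have cyb : gclose M (21%:R * r) (g y) (dp b).
    have [|h1 h2] := scaled M (enorm (y - b)) M01; first by rewrite enorm_ge0 /=; lra.
    split; [|exact: le_trans wb _|exact: le_trans gb _].
    by apply: le_trans h1; rewrite ler_peMl ?enorm_ge0.
  have cxa : gclose M (21%:R * r) (g x) (dp a).
    have [|h1 h2] := scaled M (enorm (x - a)) M01; first by rewrite enorm_ge0 /=; lra.
    split; [|exact: le_trans wa _|exact: le_trans ga _].
    by apply: le_trans h1; rewrite ler_peMl ?enorm_ge0.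
  have cba : gclose M (21%:R * r) (dp b) (dp a).
    have [|h1 h2] := scaled M (enorm (b - a)) M01; first by rewrite enorm_ge0.
    split.
    - by apply: le_trans h1; rewrite ler_peMl ?enorm_ge0.
    - apply: le_trans (wL b a Xb Xa) (le_trans _ h1).
      by rewrite ler_wpM2r ?enorm_ge0.
    - apply: le_trans (gL b a Xb Xa) (le_trans _ h2).
      by rewrite ler_wpM2r ?sqr_ge0.
  have [_ h2 h3] := chain _ _ _ _ _ r21 cyb cba cxa.
  split.
    apply: le_trans h2 _.
    have -> : 441%:R * M4 * r = M4 * (21%:R * r) + 420%:R * (M4 * r) by ring.
    by rewrite lerDl !mulr_ge0 // ltW.
  by apply: le_trans h3 _; apply: eq_ler; ring.
split.
- move=> x xU; rewrite /w'; case: ifP => _; last by case: (wt0P x).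
  exact: wh_dir_perp iso data pX prP x.
- by move=> y x yU xU; case: (pair x y xU yU).
- by move=> y x yU xU; case: (pair x y xU yU).
Qed.

End Extension.

(** * Intrinsic Lipschitz maps as jets *)

Section Translation.
Variables (R : realType) (n : nat) (U : {vspace 'rV[R]_(n + n)}).
Local Notation V := 'rV[R]_(n + n).

Lemma hnorm_le (a : V) (r b : R) : 0 <= b ->
  hnorm (Heis a r) <= b <-> enorm a <= b /\ `|r| <= b ^+ 2.
Proof.
move=> b0; rewrite /hnorm /= ge_max.
have -> : (Num.sqrt `|r| <= b) = (`|r| <= b ^+ 2).
  have bE : Num.sqrt (b ^+ 2) = b by rewrite sqrtr_sqr ger0_norm.
  by rewrite -{1}bE ler_sqrt ?sqr_ge0.
by split=> /andP.
Qed.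

Hypothesis iso : isotropic U.

(** The group law turns into [gap] because the form vanishes on the subgroup. *)
Lemma proj_graph_difference (v v' p p' : heis R n) :
  hsub U v -> hsub U v' -> vsub U p -> vsub U p' ->
  projV U ((v' * p')^-1 * (v * p))%g = Heis (hx v - hx v') 0 /\
  projW U ((v' * p')^-1 * (v * p))%g
    = Heis (hx p - hx p') (gap (GPoint (hx v) (hx p) (ht p)) (GPoint (hx v') (hx p') (ht p'))).
Proof.
case: v v' p p' => [x r] [x' r'] [w t] [w' t'].
move=> [/= xU ->] [/= x'U ->] pw pw'; apply: proj_unique.
- by split=> //=; rewrite memvB.
- exact: perpB.
rewrite !heis_mulE !heis_invE /= /gap /=; congr Heis.
  by apply/rowP => i; rewrite !mxE; ring.
rewrite !(omegaDl, omegaDr, omegaNl, omegaNr).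
rewrite (omega_anti w' x) (iso x'U xU).
by field.
Qed.

End Translation.


Section GraphExtension.
Variable R : realType.

Lemma jet_data_weaken n (U : {vspace 'rV[R]_(n + n)}) A A' B B' X w t :
  A <= A' -> B <= B' -> jet_data U A B X w t -> jet_data U A' B' X w t.
Proof.
move=> AA BB [h1 h2 h3]; split=> // p p' Xp Xp'.
- by apply: le_trans (h2 p p' Xp Xp') _; rewrite ler_wpM2r ?enorm_ge0.
- by apply: le_trans (h3 p p' Xp Xp') _; rewrite ler_wpM2r ?sqr_ge0.
Qed.

(** The homogeneous norm being a maximum, the intrinsic Lipschitz condition
splits into the two inequalities of a jet. *)
Lemma lipschitz_extension_of_jets n k (L L' : R) : 0 <= L -> 0 <= L' ->
  (forall U : {vspace 'rV[R]_(n + n)}, \dim U = k -> isotropic U ->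
   forall X w t, X `<=` [set x | x \in U] -> jet_data U L (L ^+ 2) X w t ->
   exists w' t', [/\ forall x, X x -> w' x = w x, forall x, X x -> t' x = t x
     & jet_data U L' (L' ^+ 2) [set x | x \in U] w' t']) ->
  lipschitz_extension n k L L'.
Proof.
move=> L0 L'0 ext U dimU iso E phi EU Ephi lip.
pose X := [set x | E (Heis x 0)].
pose w x := hx (phi (Heis x 0)); pose t x := ht (phi (Heis x 0)).
have XU : X `<=` [set x | x \in U] by move=> x /EU[].
have lipE (M : R) f v v' : 0 <= M ->
    hsub U v -> hsub U v' -> vsub U (f v) -> vsub U (f v') ->
    (hnorm (projW U ((v' * f v')^-1 * (v * f v))%g)
      <= M * hnorm (projV U ((v' * f v')^-1 * (v * f v))%g)) <->
    enorm (hx (f v) - hx (f v')) <= M * enorm (hx v - hx v') /\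
    `|gap (GPoint (hx v) (hx (f v)) (ht (f v))) (GPoint (hx v') (hx (f v')) (ht (f v')))|
      <= M ^+ 2 * enorm (hx v - hx v') ^+ 2.
  move=> M0 Uv Uv' Wf Wf'; have [-> ->] := proj_graph_difference iso Uv Uv' Wf Wf'.
  have -> : hnorm (Heis (hx v - hx v') 0) = enorm (hx v - hx v').
    by rewrite /hnorm /= normr0 sqrtr0; apply/max_l/enorm_ge0.
  by rewrite -exprMn; apply: hnorm_le; rewrite mulr_ge0 ?enorm_ge0.
have data : jet_data U L (L ^+ 2) X w t.
  split=> [p Xp|p p' Xp Xp'|p p' Xp Xp']; first exact: Ephi.
  - by have [] := (lipE L phi (Heis p 0) (Heis p' 0) L0 (EU _ Xp) (EU _ Xp')
      (Ephi _ Xp) (Ephi _ Xp')).1 (lip _ _ Xp Xp').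
  - by have [] := (lipE L phi (Heis p 0) (Heis p' 0) L0 (EU _ Xp) (EU _ Xp')
      (Ephi _ Xp) (Ephi _ Xp')).1 (lip _ _ Xp Xp').
have [w' [t' [w'E t'E [h1 h2 h3]]]] := ext U dimU iso X w t XU data.
exists (fun v => Heis (w' (hx v)) (t' (hx v))); split.
- by move=> v [vU _]; exact: h1.
- move=> v Ev; have [_ v0] := EU _ Ev.
  have vE : v = Heis (hx v) 0 by case: v v0 {Ev} => x r /= ->.
  have Xv : X (hx v) by rewrite /X /= -vE.
  by rewrite w'E // t'E // /w /t -vE; case: (phi v).
- move=> v v' Uv Uv' /=; have [vU _] := Uv; have [v'U _] := Uv'.
  apply/(lipE L' (fun v => Heis (w' (hx v)) (t' (hx v)))) => //.
  + exact: h1.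
  + exact: h1.
  + by split; [exact: h2|exact: h3].
Qed.

(** * The first Heisenberg group *)

Section Plane.
Variable U : {vspace 'rV[R]_(1 + 1)}.
Hypothesis dimU : \dim U = 1%N.
Implicit Types a b h : 'rV[R]_(1 + 1).

Lemma dot2 a b : dot a b
  = a 0 (lshift 1 0) * b 0 (lshift 1 0) + a 0 (rshift 1 0) * b 0 (rshift 1 0).
Proof. by rewrite /dot big_split_ord !big_ord1. Qed.

Lemma omega2 a b : omega a b
  = a 0 (lshift 1 0) * b 0 (rshift 1 0) - b 0 (lshift 1 0) * a 0 (rshift 1 0).
Proof. by rewrite /omega big_ord1. Qed.

(** Two vectors orthogonal to a common line of the plane are parallel. *)
Lemma perp_line_omega0 a b : perp U a -> perp U b -> omega a b = 0.
Proof.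
move=> pa pb; pose u := vpick U.
have u0 : u != 0 by rewrite vpick0 -dimv_eq0 dimU.
have := pa u (memv_pick U); have := pb u (memv_pick U).
have uu : dot u u != 0 by apply: contraNneq u0 => /dot_eq0 ->.
rewrite !dot2 omega2 in uu *; set u1 := u 0 _ in uu *; set u2 := u 0 _ in uu *.
set a1 := a 0 _; set a2 := a 0 _; set b1 := b 0 _; set b2 := b 0 _ => hb ha.
apply: (mulfI uu); rewrite mulr0.
have -> : (u1 * u1 + u2 * u2) * (a1 * b2 - b1 * a2)
  = (u1 * b2 - u2 * b1) * (u1 * a1 + u2 * a2) - (u1 * a2 - u2 * a1) * (u1 * b1 + u2 * b2).
  ring.
by rewrite ha hb !mulr0 subrr.
Qed.

Lemma line_perp_norm h b : h \in U -> perp U b -> enorm h * enorm b <= `|omega h b|.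
Proof.
move=> hU pb; rewrite -(ler_pXn2r (n := 2)) ?nnegrE ?mulr_ge0 ?enorm_ge0 //.
rewrite exprMn !enorm_sqr real_normK ?num_real //.
have := pb h hU; rewrite !dot2 omega2.
set h1 := h 0 _; set h2 := h 0 _; set b1 := b 0 _; set b2 := b 0 _ => hb.
have -> : (h1 * h1 + h2 * h2) * (b1 * b1 + b2 * b2)
  = (h1 * b2 - b1 * h2) ^+ 2 + (h1 * b1 + h2 * b2) ^+ 2 by ring.
by rewrite hb expr0n addr0.
Qed.

(** Symmetrising the bound on the gap bounds the directions by the square of
the Lipschitz constant. *)
Lemma line_dir_bound A B X w t : X `<=` [set x | x \in U] ->
  jet_data U A B X w t -> jet_data U (2%:R * B) B X w t.
Proof.
move=> XU [wP wL gL]; split=> // p p' Xp Xp'.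
have [->|ne] := eqVneq p p'; first by rewrite !subrr enorm0 mulr0.
have r0 : 0 < enorm (p - p').
  by rewrite lt_def enorm_ge0 andbT; apply: contraNneq ne => /enorm0_eq0/eqP;
    rewrite subr_eq0.
rewrite -(ler_pM2l r0).
have hU : p - p' \in U by apply: memvB; apply: XU.
apply: le_trans (line_perp_norm hU (perpB (wP p Xp) (wP p' Xp'))) _.
have := gap_sym (GPoint p (w p) (t p)) (GPoint p' (w p') (t p')).
have := gL p p' Xp Xp'; have := gL p' p Xp' Xp; rewrite (enormBC p' p) /=.
rewrite -(opprB (w p)) omegaNr !ler_norml => /andP[? ?] /andP[? ?] E.
by apply/andP; split; lra.
Qed.

(** The only term of the gap that is quadratic in the directions vanishes. *)
Lemma gap_scale (c : R) x x' (w w' : 'rV[R]_(1 + 1)) t t' : perp U w -> perp U w' ->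
  gap (GPoint x (c *: w) (c * t)) (GPoint x' (c *: w') (c * t'))
    = c * gap (GPoint x w t) (GPoint x' w' t').
Proof.
move=> pw pw'; rewrite /gap /= !omegaZr omegaZl (perp_line_omega0 pw' pw).
by ring.
Qed.

Lemma jet_data_scale (c A B : R) X w t : 0 <= c -> jet_data U A B X w t ->
  jet_data U (c * A) (c * B) X (fun x => c *: w x) (fun x => c * t x).
Proof.
move=> c0 [wP wL gL]; split=> [p Xp|p p' Xp Xp'|p p' Xp Xp'].
- exact/perpZ/wP.
- by rewrite -scalerBr enormZ ger0_norm // -mulrA ler_wpM2l // wL.
- rewrite gap_scale; [|exact: wP|exact: wP].
  by rewrite normrM ger0_norm // -mulrA ler_wpM2l // gL.
Qed.

(** With constants zero the direction is constant and the height affine. *)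
Lemma jet_extension0 X w t : jet_data U 0 0 X w t -> exists w' t',
  [/\ forall x, X x -> w' x = w x, forall x, X x -> t' x = t x
    & jet_data U 0 0 [set x | x \in U] w' t'].
Proof.
move=> [wP wL gL].
have [[p Xp]|nX] := pselect (X !=set0); last first.
  exists (fun=> 0), (fun=> 0); split.
  - by move=> x Xx; exfalso; apply: nX; exists x.
  - by move=> x Xx; exfalso; apply: nX; exists x.
  split=> [x _ u _|x y _ _|x y _ _]; first by rewrite dot0r.
    by rewrite subrr enorm0 mul0r.
  by rewrite /gap /= !omega0r mulr0 !subr0 add0r normr0 mul0r.
have wE x : X x -> w x = w p.
  move=> Xx; apply/eqP; rewrite -subr_eq0; apply/eqP/enorm0_eq0/le_anti.
  by rewrite enorm_ge0 andbT; have := wL x p Xx Xp; rewrite mul0r.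
exists (fun=> w p), (fun x => t p - omega (x - p) (w p)); split.
- by move=> x /wE.
- move=> x Xx; have := gL x p Xx Xp; rewrite mul0r normr_le0 /gap /= (wE x Xx) omegaxx.
  by rewrite mulr0 subr0 => /eqP h; apply/eqP; rewrite -subr_eq0; apply/eqP; lra.
split=> [x _|x y _ _|x y _ _]; first exact: wP.
  by rewrite subrr enorm0 mul0r.
rewrite mul0r normr_le0 /gap /= omegaxx !(omegaDl, omegaNl).
by apply/eqP; ring.
Qed.

End Plane.

End GraphExtension.

Theorem theorem1p2 (R : realType) (n k : nat) (hk : (1 <= k <= n)%N) :
  (forall L : R, 0 <= L ->
     exists2 L' : R, 0 <= L' & lipschitz_extension n k L L') /\
  (k = 1%N -> n = 1%N ->
     exists2 C : R, 1 <= C &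
       forall L : R, 0 <= L ->
         lipschitz_extension n k L (C * Num.max L (L ^+ 2))).
Proof.
split=> [L L0|k1 n1].
  have A1 : 1 <= 1 + L + L ^+ 2 by have := sqr_ge0 L; lra.
  have [K K0 ext] := jet_extension n A1.
  exists (1 + K); first by lra.
  apply: lipschitz_extension_of_jets => //; first by lra.
  move=> U _ iso X w t XU data.
  have [|w' [t' [wE tE data']]] := ext U iso X w t XU.
    by apply: jet_data_weaken data; have := sqr_ge0 L; lra.
  by exists w', t'; split=> //; apply: jet_data_weaken data'; rewrite ?expr2; nra.
subst n k => {hk}.
have [K K0 ext] := jet_extension 1 (lexx (1 : R)).
exists (2%:R * K + 1) => [|L L0]; first by lra.
have m0 : 0 <= Num.max L (L ^+ 2) by rewrite le_max L0.
have C0 : 0 <= 2%:R * K + 1 by lra.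
apply: lipschitz_extension_of_jets => //; first by rewrite mulr_ge0.
move=> U dimU iso X w t XU data.
have [Le|Ln] := eqVneq L 0.
  rewrite Le expr0n /= maxxx mulr0 expr0n /= in data *.
  exact: jet_extension0 data.
have Lp : 0 < L ^+ 2 by rewrite exprn_gt0 // lt_def Ln.
(* In the plane the directions are bounded by the square of the constant, and
rescaling reduces to the constant one, so that the bounds scale linearly. *)
have c0 : 0 < 2%:R * L ^+ 2 by rewrite mulr_gt0.
have data1 : jet_data U 1 1 X (fun x => (2%:R * L ^+ 2)^-1 *: w x)
                              (fun x => (2%:R * L ^+ 2)^-1 * t x).
  have := jet_data_scale dimU (ltW (_ : 0 < (2%:R * L ^+ 2)^-1)) (line_dir_bound XU data).
  rewrite invr_gt0 => /(_ c0); apply: jet_data_weaken.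
    by rewrite mulVf // gt_eqF.
  by rewrite mulrC ler_pdivrMr // mul1r; lra.
have [w' [t' [wE tE data']]] := ext U iso X _ _ XU data1.
exists (fun x => (2%:R * L ^+ 2) *: w' x), (fun x => (2%:R * L ^+ 2) * t' x); split.
- by move=> x Xx; rewrite wE // scalerA divff ?scale1r // gt_eqF.
- by move=> x Xx; rewrite tE // mulrA divff ?mul1r // gt_eqF.
have L2m : L ^+ 2 <= Num.max L (L ^+ 2) by rewrite le_max lexx orbT.
have Lm : L ^+ 2 <= Num.max L (L ^+ 2) ^+ 2.
  by rewrite ler_pXn2r ?nnegrE // le_max lexx.
apply: jet_data_weaken (jet_data_scale dimU (ltW c0) data').
  by have := ler_wpM2l K0 L2m; lra.
have := ler_wpM2l (sqr_ge0 (2%:R * K + 1)) Lm; rewrite exprMn.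
have := mulr_ge0 (mulr_ge0 K0 K0) (ltW Lp); have := mulr_ge0 K0 (ltW Lp).
by rewrite !expr2; lra.
Qed.
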